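(* Let $\mathcal{H}$ be a separable Hilbert space and let $\{\psi_{\boldsymbol{j}}:\boldsymbol{j}\in\mathbb{N}^2\}$ be a frame for $\mathcal{H}$ with lower and upper frame bounds $A,B>0$ and frame operator $S$, which is intrinsically localized: there are $\gamma>0$ and $s>2$ with $|\langle\psi_{\boldsymbol{j}},\psi_{\boldsymbol{l}}\rangle|\le\gamma(1+\|\boldsymbol{j}-\boldsymbol{l}\|_2)^{-s}$ for all $\boldsymbol{j},\boldsymbol{l}\in\mathbb{N}^2$. Assume that $\mathsf{\Psi}_{\boldsymbol{n}}=[\langle\psi_{\boldsymbol{j}},\psi_{\boldsymbol{l}}\rangle]_{\boldsymbol{1}\le\boldsymbol{j},\boldsymbol{l}\le\boldsymbol{n}}$ is invertible for every $\boldsymbol{n}\in\mathbb{N}^2$, with smallest eigenvalue $\lambda_{\min}(\mathsf{\Psi}_{\boldsymbol{n}})$. Let $f\in\mathcal{H}$ satisfy, for some constant $c_0>0$, $|\langle f,\psi_{\boldsymbol{j}}\rangle|\le c_0\|\boldsymbol{j}\|_2^{-s}$ for all $\boldsymbol{j}\in\mathbb{N}^2$. For each $\boldsymbol{n}=(n_1,n_2)\in\mathbb{N}^2$ let $\boldsymbol{m}=\boldsymbol{m}(\boldsymbol{n})=(m_1,m_2)$ be given by $$m_i=n_i+\left\lceil\left(\frac{8s\gamma^2n_1n_2}{A(s-1)^2\lambda_{\min}(\mathsf{\Psi}_{\boldsymbol{n}})}\right)^{\frac{1}{s-1}}\right\rceil,\qquad i=1,2.$$ Then there exists a constant $c>0$,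 independent of $\boldsymbol{n}$, such that for every $\boldsymbol{n}\in\mathbb{N}^2$ the operator $V_{\boldsymbol{n},\boldsymbol{m}}$ is invertible on $\mathcal{H}_{\boldsymbol{n}}$ and $$\|S^{-1}f-V_{\boldsymbol{n},\boldsymbol{m}}^{-1}P_{\boldsymbol{n}}f\|\le c\,n_1^{-\frac{s-1}{2}}+c\,n_2^{-\frac{s-1}{2}}.$$
   Context: $\mathbb{N}=\{1,2,\dots\}$. For multi-indices, $\boldsymbol{1}\le\boldsymbol{j}\le\boldsymbol{n}$ means $1\le j_1\le n_1$ and $1\le j_2\le n_2$; $\|\cdot\|_2$ is the Euclidean norm on $\mathbb{R}^2$. A family $\{\psi_{\boldsymbol{j}}:\boldsymbol{j}\in\mathbb{N}^2\}\subseteq\mathcal{H}$ is a frame for $\mathcal{H}$ with frame bounds $A,B>0$ if $A\|f\|^2\le\sum_{\boldsymbol{j}\in\mathbb{N}^2}|\langle f,\psi_{\boldsymbol{j}}\rangle|^2\le B\|f\|^2$ for all $f\in\mathcal{H}$; its frame operator is $Sf=\sum_{\boldsymbol{j}\in\mathbb{N}^2}\langle f,\psi_{\boldsymbol{j}}\rangle\psi_{\boldsymbol{j}}$. For $\boldsymbol{m},\boldsymbol{n}\in\mathbb{N}^2$: $S_{\boldsymbol{m}}f=\sum_{\boldsymbol{1}\le\boldsymbol{j}\le\boldsymbol{m}}\langle f,\psi_{\boldsymbol{j}}\rangle\psi_{\boldsymbol{j}}$; $\mathcal{H}_{\boldsymbol{n}}=\mathrm{span}\{\psi_{\boldsymbol{j}}:\boldsymbol{1}\le\boldsymbol{j}\le\boldsymbol{n}\}$;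 $P_{\boldsymbol{n}}$ is the orthogonal projection of $\mathcal{H}$ onto $\mathcal{H}_{\boldsymbol{n}}$; and $V_{\boldsymbol{n},\boldsymbol{m}}=P_{\boldsymbol{n}}S_{\boldsymbol{m}}|_{\mathcal{H}_{\boldsymbol{n}}}:\mathcal{H}_{\boldsymbol{n}}\to\mathcal{H}_{\boldsymbol{n}}$. *)

(* Defs.v *)
From mathcomp Require Import all_boot all_order all_algebra.
From mathcomp Require Import sesquilinear finmap complex.
From mathcomp Require Import all_classical all_reals all_analysis.
From mathcomp Require Import summability.

Set Implicit Arguments.
Unset Strict Implicit.
Unset Printing Implicit Defensive.

Import Order.TTheory GRing.Theory Num.Theory.
Import numFieldNormedType.Exports.

Local Open Scope classical_set_scope.
Local Open Scope ring_scope.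

(* Hilbert spaces may be real or complex; [k] selects the scalar field. *)
Inductive scalars := RealScalars | ComplexScalars.

Definition scal_field (R : realType) (k : scalars) : numFieldType :=
  match k with RealScalars => R | ComplexScalars => R[i] end.

Definition sconj (R : realType) (k : scalars) : scal_field R k -> scal_field R k :=
  match k return scal_field R k -> scal_field R k with
  | RealScalars => fun x => x
  | ComplexScalars => fun x : R[i] => conjc x
  end.

Definition sre (R : realType) (k : scalars) : scal_field R k -> R :=
  match k return scal_field R k -> R with
  | RealScalars => fun x => x
  | ComplexScalars => fun x : R[i] => complex.Re x
  end.
Arguments sre {R k} x.

(* The library's norms over a field K take their values in K (as nonnegative
   real elements); this is the same norm read in R. *)
Definition nrm (R : realType) (k : scalars) (V : normedZmodType (scal_field R k))
    (x : V) : R := sre `|x|.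

(* Multi-indices are 1-based: N^2 is [N2], and values at pairs with a zero
   entry are never used. *)
Definition N2 : set (nat * nat) := [set j | (0 < j.1)%N /\ (0 < j.2)%N].

Definition box (n : nat * nat) : seq (nat * nat) :=
  [seq (j1, j2) | j1 <- iota 1 n.1, j2 <- iota 1 n.2].

Definition norm2 (R : realType) (x y : R) : R := Num.sqrt (x ^+ 2 + y ^+ 2).

Definition idx_norm (R : realType) (j : nat * nat) : R := norm2 j.1%:R j.2%:R.

Definition idx_dist (R : realType) (j l : nat * nat) : R :=
  norm2 (j.1%:R - l.1%:R) (j.2%:R - l.2%:R).

Definition separable_space (T : topologicalType) : Prop :=
  exists2 D : set T, countable D & dense D.

Section frames.
Variables (R : realType) (k : scalars).
Local Notation K := (scal_field R k).
Variables (H : completeNormedModType K) (dot : {dot H for @sconj R k}).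
Variable (psi : nat * nat -> H).

(* [dot] is linear in its first argument and conjugate-linear in its second. *)
Definition induces_norm : Prop := forall f : H, dot f f = `|f| ^+ 2.

Definition is_frame (A B : R) : Prop :=
  [/\ 0 < A, 0 < B & forall f : H,
    ((A * nrm f ^+ 2)%:E <= \esum_(j in N2) (nrm (dot f (psi j)) ^+ 2)%:E)%E /\
    (\esum_(j in N2) (nrm (dot f (psi j)) ^+ 2)%:E <= (B * nrm f ^+ 2)%:E)%E].

(* Unconditional sum over N^2: limit along the finite sets of indices. *)
Definition frame_op (f : H) : H :=
  summability.sum (fun j => if j \in N2 then dot f (psi j) *: psi j else 0).

Definition intrinsically_localized (gamma s : R) : Prop :=
  forall j l, N2 j -> N2 l ->
    nrm (dot (psi j) (psi l)) <= gamma * (1 + idx_dist R j l) `^ (- s).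

Definition gram (n : nat * nat) : 'M[K]_(size (box n)) :=
  \matrix_(a, b) dot (psi (nth (0, 0)%N (box n) a))
                     (psi (nth (0, 0)%N (box n) b)).

Definition partial_frame_op (m : nat * nat) (f : H) : H :=
  \sum_(j <- box m) dot f (psi j) *: psi j.

Definition Hn (n : nat * nat) : set H :=
  [set f | exists c : nat * nat -> K, f = \sum_(j <- box n) c j *: psi j].

Definition is_orth_proj (E : set H) (f g : H) : Prop :=
  E g /\ forall h, E h -> dot (f - g) h = 0.

(* The default values 0 of [xget] and ['pinv_] below are attained only where no
   projection, resp. preimage, exists. *)
Definition Pn (n : nat * nat) (f : H) : H := xget 0 (is_orth_proj (Hn n) f).

Definition Vnm (n m : nat * nat) (f : H) : H := Pn n (partial_frame_op m f).

Definition frame_op_inv : H -> H := 'pinv_(fun=> 0) setT frame_op.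

Definition Vnm_inv (n m : nat * nat) : H -> H :=
  'pinv_(fun=> 0) (Hn n) (Vnm n m).

End frames.

(* The spectrum is finite, so this infimum is the smallest eigenvalue of a
   Hermitian matrix of positive size. *)
Definition lambda_min (R : realType) (k : scalars) (p : nat)
    (M : 'M[scal_field R k]_p) : R :=
  inf [set sre a | a in [set a | eigenvalue M a]].

(* Main.v *)
(* Write G for the infinite Gram matrix, S for the frame operator, g_k = S^-k f and
   x_k = (<g_k, psi_j>)_j, so that G x_(k+1) = x_k. The point is that the decay of
   x_0 passes to x_1 and x_2, without any inverse-closed matrix algebra. Take the
   weight w_j = min(max(|j|, r), M)^(s/2), where |j| = max(j_1, j_2). The commutator
   of G and w is small relative to w when r is large, uniformly in M: its entries
   are dominated by a small multiple of a convolution kernel when |j| <= 2 |l|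
   (Schur test) and of a rank-one kernel otherwise. As G is bounded below on its
   range, the norms a_k of w x_k satisfy, for small eps,
     A a_(k+1) <= a_k + eps (a_(k+1) + a_(k+2)),
   and since a_k = O(A^-k) this forces A a_(k+1) <= 2 a_k. Letting M tend to
   infinity, the l2 tails of x_1 and x_2 outside the box of n are
   O(min(n_1, n_2)^(-s/2)).
   The choice of m bounds the part of the frame sum of h in H_n outside the box of
   m by A/2 |h|^2, so S_m is coercive on H_n with constant A/2. Comparing
   V^-1 P_n f with h = sum_(j <= n) x_2(j) psi_j, whose distance to S^-1 f is
   controlled by the tail of x_2, gives the estimate. *)

(* A redundant frame may have a Gram matrix G with a kernel, so the lower bound A holds only for
   coefficient sequences of vectors, and w x_k need not be one. It is therefore replaced by G w
   x_(k+1), which is the coefficient sequence of a vector and differs from w G x_(k+1) = w x_k by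
   the commutator. This detour brings a_(k+2) into the inequality for a_(k+1), so the inequality
   cannot be iterated forward from a_0 and has to be closed by a growth argument on the whole
   sequence. The cap M serves that argument: it makes every a_k finite, and the M-dependent bound on
   A^k a_k enters only qualitatively. The sequence x_2 appears because S^-1 f = sum_j x_2(j) psi_j:
   the coefficients of this expansion of S^-1 f are those of S^-2 f. The condition s > 2 leaves room
   for a loss eta > 0 with s/2 - eta > 1: a power eta of the decay is traded for the small factor
   r^-eta, and what remains is still summable in each of the two coordinates. *)
From HB Require Import structures.
Require Import Defs.
From mathcomp Require Import all_boot all_order all_algebra.
From mathcomp Require Import sesquilinear finmap complex.
From mathcomp Require Import all_classical all_reals all_analysis.
From mathcomp Require Import summability ring lra zify.

Set Implicit Arguments.
Unset Strict Implicit.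
Unset Printing Implicit Defensive.

Import Order.TTheory GRing.Theory Num.Theory.
Import numFieldNormedType.Exports.

Local Open Scope classical_set_scope.
Local Open Scope ring_scope.

(** * Scalars and inner products *)

Section scalars.
Context {R : realType} {k : scalars}.
Local Notation K := (scal_field R k).

(** With [sre] as its retraction, it lets the real and complex cases be treated at once: past this
    section only [sconjM] splits on [k]. *)
Definition inK : R -> K :=
  match k return R -> scal_field R k with
  | RealScalars => fun x => x
  | ComplexScalars => fun x => x%:C%C
  end.

Lemma inK_sub : {morph inK : x y / x - y}.
Proof. by rewrite /inK; case: k => //= x y; rewrite rmorphB. Qed.

Lemma inK_mul : {morph inK : x y / x * y}.
Proof. by rewrite /inK; case: k => //= x y; rewrite rmorphM. Qed.

Lemma inK_1 : inK 1 = 1.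
Proof. by rewrite /inK; case: k. Qed.

HB.instance Definition _ := GRing.isZmodMorphism.Build R K inK inK_sub.
HB.instance Definition _ := GRing.isMonoidMorphism.Build R K inK (conj inK_1 inK_mul).

Lemma sre_sub : {morph (@sre R k) : x y / x - y}.
Proof. by rewrite /sre; case: k => //= x y; case: x y => [a b] [c d]. Qed.

HB.instance Definition _ := GRing.isZmodMorphism.Build K R (@sre R k) sre_sub.

Lemma inKK x : sre (inK x) = x.
Proof. by rewrite /inK /sre; case: k. Qed.

Lemma ler_inK x y : (inK x <= inK y) = (x <= y).
Proof. by rewrite /inK; case: k => //=; rewrite lecR. Qed.

Lemma ltr_inK x y : (inK x < inK y) = (x < y).
Proof. by rewrite /inK; case: k => //=; rewrite ltcR. Qed.

Lemma ge0_inK (a : K) : 0 <= a -> a = inK (sre a).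
Proof.
rewrite /inK /sre; case: k a => //= -[a b] /=.
by rewrite lecE /= => /andP[/eqP -> _].
Qed.

Lemma sre_ge0 (a : K) : 0 <= a -> 0 <= sre a.
Proof. by move=> a0; rewrite -ler_inK rmorph0 -ge0_inK. Qed.

Lemma normK_nrm (V : normedZmodType K) (x : V) : `|x| = inK (nrm x).
Proof. by rewrite /nrm -ge0_inK. Qed.

Lemma nrm_ge0 (V : normedZmodType K) (x : V) : 0 <= nrm x.
Proof. exact: sre_ge0. Qed.

Lemma nrmD (V : normedZmodType K) (x y : V) : nrm (x + y) <= nrm x + nrm y.
Proof. by rewrite -ler_inK rmorphD /= -!normK_nrm ler_normD. Qed.

Lemma nrmN (V : normedZmodType K) (x : V) : nrm (- x) = nrm x.
Proof. by rewrite /nrm normrN. Qed.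

Lemma nrm0 (V : normedZmodType K) : nrm (0 : V) = 0.
Proof. by rewrite /nrm normr0 raddf0. Qed.

Lemma nrm_eq0 (V : normedZmodType K) (x : V) : nrm x = 0 -> x = 0.
Proof. by move=> x0; apply/eqP; rewrite -normr_eq0 normK_nrm x0 rmorph0. Qed.

Lemma nrmB (V : normedZmodType K) (x y : V) : nrm (x - y) <= nrm x + nrm y.
Proof. by rewrite (le_trans (nrmD _ _)) // nrmN. Qed.

Lemma nrm_distC (V : normedZmodType K) (x y : V) : nrm (x - y) = nrm (y - x).
Proof. by rewrite -nrmN opprB. Qed.

Lemma nrm_sum (V : normedZmodType K) I (r : seq I) (P : pred I) (F : I -> V) :
  nrm (\sum_(i <- r | P i) F i) <= \sum_(i <- r | P i) nrm (F i).
Proof.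
elim/big_ind2 : _ => [|x a y b xa yb|//]; first by rewrite nrm0.
exact: le_trans (nrmD _ _) (lerD _ _).
Qed.

Lemma nrmM (a b : K) : nrm (a * b) = nrm a * nrm b.
Proof.
by apply: (can_inj inKK); rewrite rmorphM /= -!normK_nrm normrM.
Qed.

Lemma nrmZ (V : normedModType K) (a : K) (x : V) : nrm (a *: x) = nrm a * nrm x.
Proof.
by apply: (can_inj inKK); rewrite rmorphM /= -!normK_nrm normrZ.
Qed.

Lemma nrm_inK (x : R) : nrm (inK x) = `|x|.
Proof. by rewrite /nrm /inK /sre; case: k => //=; rewrite expr0n addr0 sqrtr_sqr. Qed.

Lemma sre_le_nrm (a : K) : sre a <= nrm a.
Proof.
rewrite /nrm /sre; case: k a => /= [a|[a b] /=]; first exact: ler_norm.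
rewrite (le_trans (ler_norm _)) // -sqrtr_sqr ler_sqrt ?lerDl ?sqr_ge0 //.
by rewrite addr_ge0 ?sqr_ge0.
Qed.

Lemma sre_mul_inK (a : R) (b : K) : sre (inK a * b) = a * sre b.
Proof. by rewrite /sre /inK; case: k b => //= -[b c]; rewrite /= mul0r subr0. Qed.

Lemma sconjD : {morph (@sconj R k) : x y / x + y}.
Proof. by rewrite /sconj; case: k => //= x y; rewrite rmorphD. Qed.

Lemma sconj_inK (x : R) : sconj (inK x) = inK x.
Proof. by rewrite /sconj /inK; case: k => //=; rewrite oppr0. Qed.

Lemma sconj_inK_mul (x : R) (a : K) : sconj (inK x * a) = inK x * sconj a.
Proof.
by rewrite /sconj /inK; case: k a => //= -[a b]; simpc; rewrite ?mulrN.
Qed.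

Lemma sconjK : involutive (@sconj R k).
Proof. by rewrite /sconj; case: k => //= -[a b] /=; rewrite opprK. Qed.

Lemma nrm_sconj (a : K) : nrm (sconj a) = nrm a.
Proof. by rewrite /nrm /sconj /sre; case: k a => //= -[a b] /=; rewrite sqrrN. Qed.

Lemma mul_sconj (a : K) : a * sconj a = inK (nrm a ^+ 2).
Proof.
rewrite /nrm /sconj /sre /inK; case: k a => /= [a|[a b] /=].
  by rewrite real_normK ?num_real ?expr2.
rewrite sqr_sqrtr ?addr_ge0 ?sqr_ge0 //; simpc.
by rewrite -!expr2 [b * a]mulrC addNr.
Qed.

Lemma sre_sconj (a : K) : sre (sconj a) = sre a.
Proof. by rewrite /sre /sconj; case: k a => //= -[a b]. Qed.

End scalars.

Section inner_product.
Context {R : realType} {k : scalars}.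
Local Notation K := (scal_field R k).
Variables (H : completeNormedModType K) (dot : {dot H for @sconj R k}).
Hypothesis dot_norm : induces_norm dot.

Lemma dotDl x y z : dot (x + y) z = dot x z + dot y z.
Proof. exact: linearDl. Qed.
Lemma dotDr x y z : dot x (y + z) = dot x y + dot x z.
Proof. exact: linearDr. Qed.
Lemma dotBl x y z : dot (x - y) z = dot x z - dot y z.
Proof. exact: linearBl. Qed.
Lemma dotBr x y z : dot x (y - z) = dot x y - dot x z.
Proof. exact: linearBr. Qed.
Lemma dot0l x : dot 0 x = 0.
Proof. exact: linear0l. Qed.
Lemma dot0r x : dot x 0 = 0.
Proof. exact: linear0r. Qed.
Lemma dotZl a x y : dot (a *: x) y = a * dot x y.
Proof. exact: linearZl_LR. Qed.
Lemma dotZr a x y : dot x (a *: y) = sconj a * dot x y.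
Proof. exact: linearZr_LR. Qed.
Lemma dotC x y : dot x y = sconj (dot y x).
Proof. by rewrite (@hermitian_subproof _ _ _ _ dot) expr0 mul1r. Qed.
Lemma dot_suml I (r : seq I) (P : pred I) (F : I -> H) y :
  dot (\sum_(i <- r | P i) F i) y = \sum_(i <- r | P i) dot (F i) y.
Proof. by elim/big_rec2 : _ => [|i a b _ <-]; rewrite ?dot0l ?dotDl. Qed.
Lemma dot_sumr I (r : seq I) (P : pred I) (F : I -> H) y :
  dot y (\sum_(i <- r | P i) F i) = \sum_(i <- r | P i) dot y (F i).
Proof. by elim/big_rec2 : _ => [|i a b _ <-]; rewrite ?dot0r ?dotDr. Qed.

Lemma dotxx x : dot x x = inK (nrm x ^+ 2).
Proof. by rewrite dot_norm normK_nrm rmorphXn. Qed.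

Lemma sre_dotC x y : sre (dot x y) = sre (dot y x).
Proof. by rewrite dotC sre_sconj. Qed.

Lemma nrm_dotC x y : nrm (dot x y) = nrm (dot y x).
Proof. by rewrite dotC nrm_sconj. Qed.

Lemma nrm_sqrB x y :
  nrm (x - y) ^+ 2 = nrm x ^+ 2 - sre (dot x y) *+ 2 + nrm y ^+ 2.
Proof.
rewrite -(@inKK R k (nrm (x - y) ^+ 2)) -dotxx dotBl !dotBr !dotxx !raddfB /= !inKK.
by rewrite [sre (dot y x)]sre_dotC; ring.
Qed.

Lemma dot_CS x y : nrm (dot x y) <= nrm x * nrm y.
Proof.
have [->|y0] := eqVneq y 0; first by rewrite dot0r !nrm0 mulr0.
have ny0 : 0 < nrm y.
  by rewrite lt_neqAle nrm_ge0 andbT eq_sym; apply: contra_neq y0; exact: nrm_eq0.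
have := sqr_ge0 (nrm (x - (inK (nrm y ^- 2) * dot x y) *: y)).
rewrite nrm_sqrB nrmZ nrmM nrm_inK dotZr -mulrA.
have -> : sconj (inK (nrm y ^- 2) * dot x y) * dot x y
          = inK (nrm y ^- 2 * nrm (dot x y) ^+ 2).
  by rewrite sconj_inK_mul -mulrA [sconj _ * _]mulrC mul_sconj -rmorphM.
rewrite inKK ger0_norm ?invr_ge0 ?exprn_ge0 ?nrm_ge0//.
have -> : nrm x ^+ 2 - (nrm y ^- 2 * nrm (dot x y) ^+ 2) *+ 2 +
   (nrm y ^- 2 * (nrm (dot x y) * nrm y)) ^+ 2 =
   nrm x ^+ 2 - (nrm (dot x y) / nrm y) ^+ 2.
  by field; rewrite gt_eqF.
rewrite subr_ge0 ler_sqr ?nnegrE ?divr_ge0 ?nrm_ge0//.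
by rewrite ler_pdivrMr.
Qed.

End inner_product.

(** * Unconditional sums *)

Lemma big_fset_split (V : nmodType) (I : choiceType) (F0 F : {fset I}) (y : I -> V) :
  (F0 `<=` F)%fset ->
  \sum_(i <- F) y i = \sum_(i <- F0) y i + \sum_(i <- (F `\` F0)%fset) y i.
Proof.
move=> sF; rewrite (big_fsetID _ (mem F0)) /=; congr (_ + _).
  apply: eq_fbigl => x; rewrite !inE /=.
  by case: (boolP (x \in F0)) => [/(fsubsetP sF) ->|_]; rewrite ?andbF.
by apply: eq_fbigl => x; rewrite !inE /= andbC.
Qed.

Section unconditional_sums.
Context {R : realType} {k : scalars}.
Local Notation K := (scal_field R k).
Variable I : choiceType.
Implicit Types F : {fset I}.

#[local] Existing Instance totally_filter.

(** Convergence along finite index sets, unfolded with a real tolerance. It makes sense in K itself,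
    so inner products of sums need no separate notion; [sums_to_sum] returns to
    [summability.sum]. *)
Definition sums_to (V : normedZmodType K) (y : I -> V) (l : V) : Prop :=
  forall e : R, 0 < e -> exists F0, forall F, (F0 `<=` F)%fset ->
    nrm (\sum_(i <- F) y i - l) < e.

Section normed_zmod.
Variable V : normedZmodType K.
Implicit Types (y z : I -> V) (l : V).

Lemma sums_to_eq y z l : y =1 z -> sums_to y l -> sums_to z l.
Proof. by move=> /funext ->. Qed.

Lemma sums_toB y z l l' :
  sums_to y l -> sums_to z l' -> sums_to (fun i => y i - z i) (l - l').
Proof.
move=> yl zl e e0; have e20 : 0 < e / 2 by rewrite divr_gt0.
have [F1 h1] := yl _ e20; have [F2 h2] := zl _ e20.
exists (F1 `|` F2)%fset => F; rewrite fsubUset => /andP[/h1 {}h1 /h2 {}h2].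
rewrite big_split /= sumrN opprB [l' - l]addrC addrACA [- _ + l']addrC -[l' - _]opprB.
by apply: le_lt_trans (nrmB _ _) _; rewrite [e]splitr ltrD.
Qed.

Lemma sums_to_le y l C : sums_to y l ->
  (forall F, nrm (\sum_(i <- F) y i) <= C) -> nrm l <= C.
Proof.
move=> yl yC; apply/ler_addgt0Pr => e e0; have [F0 /(_ F0) h] := yl _ e0.
rewrite -[l](subrK (\sum_(i <- F0) y i)) (le_trans (nrmD _ _)) // addrC lerD ?yC//.
by rewrite nrm_distC ltW // h.
Qed.

Lemma sums_to_finite y F0 : (forall i, i \notin F0 -> y i = 0) ->
  sums_to y (\sum_(i <- F0) y i).
Proof.
move=> y0 e e0; exists F0 => F sF.
rewrite -(big_fset_incl _ sF) ?subrr ?nrm0 // => i _ /y0 //.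
Qed.

End normed_zmod.

Lemma partial_sumE (V : zmodType) (y : I -> V) F : partial_sum y F = \sum_(i <- F) y i.
Proof. by rewrite /partial_sum -(big_seq_fsetE _ _ xpredT y). Qed.

Lemma sums_to_sum (V : normedModType K) (y : I -> V) l :
  sums_to y l -> summability.sum y = l.
Proof.
move=> yl; apply: cvg_lim; first exact: norm_hausdorff.
apply/cvgrPdist_lt => e e0.
have : 0 < sre e by rewrite -(ltr_inK (k:=k)) rmorph0 -ge0_inK // ltW.
move=> /yl[F0 h]; exists F0 => // F /= /h hF.
rewrite partial_sumE distrC normK_nrm (@ge0_inK _ _ e) ?ltW//.
by rewrite ltr_inK.
Qed.

Lemma sums_toZ (V : normedModType K) (a : K) (y : I -> V) l :
  sums_to y l -> sums_to (fun i => a *: y i) (a *: l).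
Proof.
move=> yl e e0.
have a0 : 0 < nrm a + 1 by rewrite ltr_wpDl ?nrm_ge0.
have [F0 h] := yl _ (divr_gt0 e0 a0); exists F0 => F /h {}h.
rewrite -scaler_sumr -scalerBr nrmZ.
apply: (@le_lt_trans _ _ ((nrm a + 1) * nrm (\sum_(i <- F) y i - l))).
  by rewrite ler_wpM2r ?nrm_ge0// lerDl.
by rewrite mulrC -ltr_pdivlMr.
Qed.

Lemma sums_to_complete (V : completeNormedModType K) (y : I -> V) :
  (forall e : R, 0 < e -> exists F0, forall F, [disjoint F0 & F]%fset ->
     nrm (\sum_(i <- F) y i) < e) ->
  exists l, sums_to y l.
Proof.
move=> yC.
have /cauchy_cvg : cauchy (partial_sum y @ totally).
  apply/cauchy_ballP => e e0; near_simpl.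
  have se0 : 0 < sre e / 2.
    by rewrite divr_gt0 // -(ltr_inK (k:=k)) rmorph0 -ge0_inK // ltW.
  have [F0 h] := yC _ se0.
  have hF F : (F0 `<=` F)%fset -> nrm (\sum_(i <- F) y i - \sum_(i <- F0) y i) < sre e / 2.
    move=> sF.
    rewrite (big_fset_split _ sF) addrAC subrr add0r; apply: h.
    by apply/fdisjointP => x xF0; rewrite inE xF0.
  exists ([set F | (F0 `<=` F)%fset], [set F | (F0 `<=` F)%fset]).
    by split; exists F0.
  move=> [F1 F2] [/= /hF h1 /hF h2].
  rewrite -ball_normE /ball_ /= !partial_sumE normK_nrm.
  rewrite (@ge0_inK _ _ e) ?ltW// ltr_inK.
  rewrite -[X in X - _](subrK (\sum_(i <- F0) y i)) -addrA.
  apply: le_lt_trans (nrmD _ _) _; rewrite [sre e]splitr ltrD //.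
  by rewrite nrm_distC.
move=> /cvg_ex[/= l yl]; exists l => e e0.
have e0K : 0 < inK e :> K by rewrite -[0](rmorph0 inK) ltr_inK.
have /cvgrPdist_lt /(_ _ e0K)[F0 _ h] := yl.
exists F0 => F /h /=.
by rewrite partial_sumE distrC normK_nrm ltr_inK.
Unshelve. all: by end_near. Qed.

Lemma sums_to_dotl (H : completeNormedModType K) (dot : {dot H for @sconj R k})
    (y : I -> H) l h : induces_norm dot ->
  sums_to y l -> sums_to (fun i => dot (y i) h) (dot l h).
Proof.
move=> dn yl e e0.
have a0 : 0 < nrm h + 1 by rewrite ltr_wpDl ?nrm_ge0.
have [F0 hF] := yl _ (divr_gt0 e0 a0); exists F0 => F /hF {}hF.
rewrite -dot_suml -dotBl; apply: le_lt_trans (dot_CS dn _ _) _.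
apply: (@le_lt_trans _ _ (nrm (\sum_(i <- F) y i - l) * (nrm h + 1))).
  by rewrite ler_wpM2l ?nrm_ge0// lerDl.
by rewrite -ltr_pdivlMr.
Qed.

End unconditional_sums.

(** * The frame operator *)

Lemma sum_CS (R : realFieldType) (I : Type) (r : seq I) (a b : I -> R) :
  (\sum_(i <- r) a i * b i) ^+ 2 <=
  (\sum_(i <- r) a i ^+ 2) * (\sum_(i <- r) b i ^+ 2).
Proof.
elim: r => [|i r ih]; first by rewrite !big_nil mulr0 expr0n.
rewrite !big_cons.
set X := \sum_(j <- r) a j ^+ 2 in ih *; set Y := \sum_(j <- r) b j ^+ 2 in ih *.
set Z := \sum_(j <- r) a j * b j in ih *.
have X0 : 0 <= X by rewrite sumr_ge0 // => j _; rewrite sqr_ge0.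
have Y0 : 0 <= Y by rewrite sumr_ge0 // => j _; rewrite sqr_ge0.
(* The square of the left side is at most 4 a_i^2 b_i^2 X Y by induction, and 4 u v <= (u + v)^2. *)
suff h : a i * b i * Z *+ 2 <= X * b i ^+ 2 + a i ^+ 2 * Y.
  by rewrite -subr_ge0; have := lerD ih h; rewrite -subr_ge0; congr (0 <= _); ring.
rewrite (le_trans (ler_norm _)) // -ler_sqr ?nnegrE //; last first.
  by apply: addr_ge0; apply: mulr_ge0 => //; apply: sqr_ge0.
rewrite real_normK ?num_real//.
apply: (@le_trans _ _ ((a i * b i) ^+ 2 * (X * Y) *+ 4)).
  have -> : (a i * b i * Z *+ 2) ^+ 2 = (a i * b i) ^+ 2 * Z ^+ 2 *+ 4 by ring.
  by rewrite lerMn2r ler_wpM2l ?sqr_ge0.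
rewrite -subr_ge0; have := sqr_ge0 (X * b i ^+ 2 - a i ^+ 2 * Y).
by congr (0 <= _); ring.
Qed.

Section l2.
Context {R : realType} {k : scalars}.
Local Notation K := (scal_field R k).

(** No space of square-summable sequences is formed: a norm over all indices is a bound on [l2 F]
    uniform in the finite set F. *)
Definition l2 (I : Type) (r : seq I) (x : I -> K) : R :=
  Num.sqrt (\sum_(i <- r) nrm (x i) ^+ 2).

Section finite.
Variable I : Type.
Implicit Types (r : seq I) (x y : I -> K).

Lemma l2_ge0 r x : 0 <= l2 r x.
Proof. exact: sqrtr_ge0. Qed.

Lemma sqr_l2 r x : l2 r x ^+ 2 = \sum_(i <- r) nrm (x i) ^+ 2.
Proof. by rewrite sqr_sqrtr // sumr_ge0 // => i _; rewrite sqr_ge0. Qed.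

Lemma l2_le r x C : 0 <= C ->
  (l2 r x <= C) = (\sum_(i <- r) nrm (x i) ^+ 2 <= C ^+ 2).
Proof. by move=> C0; rewrite -sqr_l2 ler_sqr ?nnegrE ?l2_ge0. Qed.

Lemma eq_l2 r x y : x =1 y -> l2 r x = l2 r y.
Proof. by move=> /funext ->. Qed.

Lemma sum_CS_l2 r x y : \sum_(i <- r) nrm (x i) * nrm (y i) <= l2 r x * l2 r y.
Proof.
rewrite -ler_sqr ?nnegrE ?mulr_ge0 ?l2_ge0 //; last first.
  by rewrite sumr_ge0 // => i _; rewrite mulr_ge0 ?nrm_ge0.
by rewrite exprMn !sqr_l2 sum_CS.
Qed.

Lemma l2D r x y : l2 r (fun i => x i + y i) <= l2 r x + l2 r y.
Proof.
rewrite l2_le ?addr_ge0 ?l2_ge0 // sqrrD.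
apply: (@le_trans _ _ (\sum_(i <- r) (nrm (x i) + nrm (y i)) ^+ 2)).
  by apply: ler_sum => i _; rewrite ler_sqr ?nnegrE ?addr_ge0 ?nrm_ge0 ?nrmD.
under eq_bigr do rewrite sqrrD.
rewrite !big_split /= !sqr_l2 lerD2r lerD2l -mulr2n.
by rewrite lerMn2r sum_CS_l2.
Qed.

Lemma l2N r x : l2 r (fun i => - x i) = l2 r x.
Proof. by rewrite /l2; under eq_bigr do rewrite nrmN. Qed.

Lemma l2B r x y : l2 r (fun i => x i - y i) <= l2 r x + l2 r y.
Proof. by rewrite (le_trans (l2D _ _ _)) // l2N. Qed.

End finite.
End l2.

Section frame_operator.
Context {R : realType} {k : scalars}.
Local Notation K := (scal_field R k).
Variables (H : completeNormedModType K) (dot : {dot H for @sconj R k}).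
Hypothesis dot_norm : induces_norm dot.
Variables (I : choiceType) (e : I -> H) (B : R).
Hypothesis B_gt0 : 0 < B.

Definition coef (h : H) (i : I) : K := dot h (e i).

Hypothesis bessel : forall (F : {fset I}) h, l2 F (coef h) <= Num.sqrt B * nrm h.

Lemma coefB h g i : coef (h - g) i = coef h i - coef g i.
Proof. exact: dotBl. Qed.

(** Synthesis is the adjoint of [coef], so it inherits the Bessel bound: pair the sum with
    itself. *)
Lemma synthesis_le (F : {fset I}) (y : I -> K) :
  nrm (\sum_(i <- F) y i *: e i) <= Num.sqrt B * l2 F y.
Proof.
set v := \sum_(i <- F) _.
have [->|v0] := eqVneq v 0; first by rewrite nrm0 mulr_ge0 ?sqrtr_ge0.
have nv : 0 < nrm v.
  by rewrite lt_neqAle nrm_ge0 andbT eq_sym; apply: contra_neq v0; exact: nrm_eq0.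
rewrite -(ler_pM2r nv) -expr2 -(@inKK R k (nrm v ^+ 2)) -(dotxx dot_norm).
rewrite (le_trans (sre_le_nrm _)) // {1}/v dot_suml (le_trans (nrm_sum _ _ _)) //.
apply: (@le_trans _ _ (\sum_(i <- F) nrm (y i) * nrm (coef v i))).
  by apply: ler_sum => i _; rewrite dotZl nrmM nrm_dotC.
rewrite (le_trans (sum_CS_l2 _ _ _)) // mulrC mulrAC ler_wpM2r ?l2_ge0 //.

Qed.

Lemma l2_tail (y : I -> K) C : (forall F : {fset I}, l2 F y <= C) ->
  forall eps : R, 0 < eps -> exists F0 : {fset I}, forall F,
    [disjoint F0 & F]%fset -> l2 F y < eps.
Proof.
move=> yC eps eps0; pose q (F : {fset I}) := \sum_(i <- F) nrm (y i) ^+ 2.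
have qsup : has_sup [set q F | F in setT].
  split; first by exists (q fset0), fset0.
  exists (C ^+ 2) => _ [F _ <-]; rewrite /q -l2_le //.
  exact: le_trans (l2_ge0 _ _) (yC fset0).
(* A finite set that nearly attains the supremum leaves little mass to any set disjoint from it. *)
have [_ [F0 _ <-] h] := sup_adherent (exprn_gt0 2 eps0) qsup.
exists F0 => F dF; rewrite -ltr_sqr ?nnegrE ?l2_ge0 ?ltW// sqr_l2 -/(q F).
have : q (F0 `|` F)%fset <= sup [set q F | F in setT].
  by apply: sup_upper_bound => //; exists (F0 `|` F)%fset.
have -> : q (F0 `|` F)%fset = q F0 + q F.
  rewrite /q (big_fset_split _ (fsubsetUl F0 F)) fsetDUl fsetDv fset0U.
  by rewrite (fsetDidPl _ _ _) // fdisjoint_sym.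
by move: h; lra.
Qed.

Lemma synthesis_cvg (y : I -> K) C : (forall F : {fset I}, l2 F y <= C) ->
  exists l, sums_to (fun i => y i *: e i) l.
Proof.
move=> yC; apply: sums_to_complete => eps eps0.
have sB : 0 < Num.sqrt B by rewrite sqrtr_gt0.
have [F0 h] := l2_tail yC (divr_gt0 eps0 sB); exists F0 => F /h {}h.
by apply: le_lt_trans (synthesis_le _ _) _; rewrite mulrC -ltr_pdivlMr.
Qed.

Definition frameop (h : H) : H := summability.sum (fun i => coef h i *: e i).
Local Notation S := frameop.

Lemma frameop_sums h : sums_to (fun i => coef h i *: e i) (S h).
Proof.
have [l sl] := synthesis_cvg (bessel^~ h).
by rewrite /frameop (sums_to_sum sl).
Qed.

Lemma frameopB h g : S (h - g) = S h - S g.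
Proof.
rewrite -(sums_to_sum (sums_toB (frameop_sums h) (frameop_sums g))).
by congr summability.sum; apply/funext => i; rewrite coefB scalerBl.
Qed.

Lemma frameopZ a h : S (a *: h) = a *: S h.
Proof.
rewrite -(sums_to_sum (sums_toZ a (frameop_sums h))).
by congr summability.sum; apply/funext => i; rewrite /coef dotZl scalerA.
Qed.

Lemma frameop_le h : nrm (S h) <= B * nrm h.
Proof.
apply: (sums_to_le (frameop_sums h)) => F.
rewrite (le_trans (synthesis_le _ _)) // -[in leRHS](sqr_sqrtr (ltW B_gt0)).
by rewrite expr2 -mulrA ler_wpM2l ?sqrtr_ge0 // bessel.
Qed.

(** The l2 norm of the whole sequence [coef h], in closed form; [l2_le_energy] and [energy_le] are
    the two halves of this identity. *)
Definition energy (h : H) : R := Num.sqrt (sre (dot (S h) h)).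

Lemma dot_frameop_partial h (F : {fset I}) :
  \sum_(i <- F) dot (coef h i *: e i) h = inK (l2 F (coef h) ^+ 2).
Proof.
rewrite sqr_l2 rmorph_sum /=; apply: eq_bigr => i _.
by rewrite dotZl /coef [dot (e i) h](dotC dot) mul_sconj.
Qed.

Lemma l2_le_energy h (F : {fset I}) : l2 F (coef h) <= energy h.
Proof.
rewrite /energy -[l2 _ _]ger0_norm ?l2_ge0 // -sqrtr_sqr ler_wsqrtr //.
apply/ler_addgt0Pr => eps eps0.
have [F0 hF0] := sums_to_dotl h dot_norm (frameop_sums h) eps0.
have := hF0 _ (fsubsetUl F0 F); rewrite dot_frameop_partial => lt_eps.
have := le_lt_trans (sre_le_nrm _) lt_eps; rewrite raddfB /= inKK => h1.
rewrite (le_trans _ (_ : l2 (F0 `|` F)%fset (coef h) ^+ 2 <= _)) //; last by lra.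
rewrite !sqr_l2 (big_fset_split _ (fsubsetUr F0 F)).
by rewrite lerDl sumr_ge0 // => i _; rewrite sqr_ge0.
Qed.

Lemma energy_le h C : 0 <= C ->
  (forall F : {fset I}, l2 F (coef h) <= C) -> energy h <= C.
Proof.
move=> C0 hC; rewrite -(ger0_norm C0) -sqrtr_sqr ler_wsqrtr //.
rewrite (le_trans (sre_le_nrm _)) //.
apply: (sums_to_le (sums_to_dotl h dot_norm (frameop_sums h))) => F.
by rewrite dot_frameop_partial nrm_inK ger0_norm ?sqr_ge0 // ler_sqr ?nnegrE ?l2_ge0.
Qed.

Lemma energy_ge0 h : 0 <= energy h.
Proof. exact: sqrtr_ge0. Qed.

Lemma energy_le_nrm h : energy h <= Num.sqrt B * nrm h.
Proof. by apply: energy_le => //; rewrite mulr_ge0 ?sqrtr_ge0 ?nrm_ge0. Qed.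

Lemma energyD h g : energy (h + g) <= energy h + energy g.
Proof.
apply: energy_le => [|F]; first by rewrite addr_ge0 ?energy_ge0.
rewrite (_ : coef (h + g) = fun i => coef h i + coef g i); last first.
  by apply/funext => i; exact: dotDl.
by rewrite (le_trans (l2D _ _ _)) // lerD ?l2_le_energy.
Qed.

Section lower_bound.
Variable A : R.
Hypothesis A_gt0 : 0 < A.
Hypothesis lower : forall h c, (forall F : {fset I}, l2 F (coef h) <= c) ->
  Num.sqrt A * nrm h <= c.

Lemma nrm_le_energy h : Num.sqrt A * nrm h <= energy h.
Proof. by apply: lower => F; exact: l2_le_energy. Qed.

Lemma sqr_energy h : energy h ^+ 2 = sre (dot (S h) h).
Proof.
rewrite /energy sqr_sqrtr //; apply/ler_addgt0Pr => eps eps0.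
have [F0 /(_ F0 (fsubset_refl _))] := sums_to_dotl h dot_norm (frameop_sums h) eps0.
rewrite dot_frameop_partial => /(le_lt_trans (sre_le_nrm _)).
by rewrite raddfB /= inKK; have := sqr_ge0 (l2 F0 (coef h)); lra.
Qed.

Lemma frameop_coercive h : A * nrm h ^+ 2 <= sre (dot (S h) h).
Proof.
rewrite -sqr_energy -[A](sqr_sqrtr (ltW A_gt0)) -exprMn ler_sqr ?nnegrE ?energy_ge0//.
  exact: nrm_le_energy.
by rewrite mulr_ge0 ?sqrtr_ge0 ?nrm_ge0.
Qed.

Lemma frameop_ge h : A * nrm h <= nrm (S h).
Proof.
have [->|h0] := eqVneq (nrm h) 0; first by rewrite mulr0 nrm_ge0.
have nh : 0 < nrm h by rewrite lt_neqAle nrm_ge0 andbT eq_sym.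
rewrite -(ler_pM2r nh) -mulrA -expr2 (le_trans (frameop_coercive _)) //.
by rewrite (le_trans (sre_le_nrm _)) // dot_CS.
Qed.

Lemma frameop_inj h g : S h = S g -> h = g.
Proof.
move=> Shg; apply/eqP; rewrite -subr_eq0; apply/eqP/nrm_eq0.
have := frameop_ge (h - g); rewrite frameopB Shg subrr nrm0 => le0.
apply/eqP; rewrite eq_le nrm_ge0 andbT.
by rewrite -(ler_pM2l A_gt0) mulr0.
Qed.

(** As [coef (S h)] is the Gram matrix applied to [coef h], this is the lower bound of that matrix
    on its range. It follows from A^2 <S h, h> <= A^2 |S h| |h| <= A |S h|^2 <= <S (S h), S h>. *)
Lemma energy_frameop h : A * energy h <= energy (S h).
Proof.
have eS : Num.sqrt A * nrm (S h) <= energy (S h) by exact: nrm_le_energy.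
have A0 := ltW A_gt0.
apply: le_trans eS; rewrite -ler_sqr ?nnegrE ?mulr_ge0 ?energy_ge0 ?sqrtr_ge0 ?nrm_ge0 //.
rewrite !exprMn (sqr_sqrtr (ltW A_gt0)) sqr_energy.
have := le_trans (sre_le_nrm _) (dot_CS dot_norm (S h) h).
have := frameop_ge h; have := nrm_ge0 (S h); have := nrm_ge0 h => h0 S0 hS dS.
rewrite expr2 -mulrA ler_pM2l //.
by apply: (@le_trans _ _ (A * (nrm (S h) * nrm h))); [rewrite ler_pM2l|nra].
Qed.

End lower_bound.

End frame_operator.

(** * Coercive operators are onto *)

Lemma ler_sum_subset (R : numDomainType) (I : eqType) (r r' : seq I) (a : I -> R) :
  uniq r -> {subset r <= r'} -> (forall i, 0 <= a i) ->
  \sum_(i <- r) a i <= \sum_(i <- r') a i.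
Proof.
move=> ur sr a0; elim: r r' ur sr => [|x r ih] r' /=.
  by rewrite big_nil sumr_ge0.
move=> /andP[xr ur] sr; have xr' : x \in r' by apply: sr; rewrite inE eqxx.
rewrite big_cons (big_rem x xr') /= lerD2l ih // => y yr.
have := sr y; rewrite inE yr orbT => /(_ isT).
rewrite (perm_mem (perm_to_rem xr')) inE => /orP[/eqP yx|//].
by rewrite -yx yr in xr.
Qed.

Lemma geometric_small (R : realType) (q C eps : R) : 0 <= q < 1 -> 0 < eps ->
  exists N, forall n, (N <= n)%N -> q ^+ n * C < eps.
Proof.
move=> /andP[q0 q1] eps0.
have C0 : 0 < `|C| + 1 by rewrite ltr_wpDl.
have qn1 : `|q| < 1 by rewrite ger0_norm.
have /cvgrPdist_lt /(_ _ (divr_gt0 eps0 C0))[N _ h] := cvg_expr qn1.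
exists N => n /h /=.
rewrite sub0r normrN ger0_norm ?exprn_ge0 // ltr_pdivlMr //.
apply: le_lt_trans; rewrite ler_wpM2l ?exprn_ge0 //.
by rewrite (le_trans (ler_norm _)) // lerDl.
Qed.

Lemma sum_geometric_le (R : realFieldType) (q : R) n N : 0 <= q < 1 ->
  (1 - q) * \sum_(i <- iota N n) q ^+ i <= q ^+ N.
Proof.
move=> /andP[q0 q1]; elim: n N => [|n ih] N /=.
  by rewrite big_nil mulr0 exprn_ge0.
by rewrite big_cons mulrDr; have := ih N.+1; rewrite exprS; lra.
Qed.

(** Neumann series: I - tau T is a contraction, and tau times the sum of its iterates at f is the
    solution. *)
Lemma lax_milgram (R : realType) (k : scalars)
    (H : completeNormedModType (scal_field R k)) (dot : {dot H for @sconj R k})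
    (T : H -> H) (A B : R) :
  induces_norm dot -> 0 < A -> 0 < B ->
  (forall h g, T (h - g) = T h - T g) -> (forall a h, T (a *: h) = a *: T h) ->
  (forall h, nrm (T h) <= B * nrm h) ->
  (forall h, A * nrm h ^+ 2 <= sre (dot (T h) h)) ->
  forall f, exists g, T g = f.
Proof.
move=> dn A0 B0 TB TZ Tle Tge f.
(* This tau minimizes 1 - 2 tau A + tau^2 B^2, the factor that coercivity and boundedness give for
   the squared norm of [U h]; the minimum is 1 - (A / B)^2. *)
pose tau : R := A / B ^+ 2; pose U h := h - inK tau *: T h.
have tau0 : 0 < tau by rewrite divr_gt0 ?exprn_gt0.
pose q := Num.sqrt (1 - (A / B) ^+ 2).
have q0 : 0 <= q := sqrtr_ge0 _.
have q1 : q < 1 by rewrite -sqrtr1 ltr_sqrt // gtrBl exprn_gt0 ?divr_gt0.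
have q01 : 0 <= q < 1 by rewrite q0.
have Uq h : nrm (U h) <= q * nrm h.
  rewrite -ler_sqr ?nnegrE ?mulr_ge0 ?nrm_ge0 // (nrm_sqrB dn) nrmZ nrm_inK.
  rewrite sre_dotC dotZl sre_mul_inK gtr0_norm //.
  apply: (@le_trans _ _ ((1 - (A / B) ^+ 2) * nrm h ^+ 2)).
    have hT : nrm (T h) ^+ 2 <= (B * nrm h) ^+ 2.
      by rewrite ler_sqr ?nnegrE ?nrm_ge0 ?mulr_ge0 ?nrm_ge0 ?(ltW B0).
    have -> : (1 - (A / B) ^+ 2) * nrm h ^+ 2 =
       nrm h ^+ 2 - tau * (A * nrm h ^+ 2) *+ 2 + tau ^+ 2 * (B * nrm h) ^+ 2.
      by rewrite /tau; field; rewrite gt_eqF.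
    rewrite exprMn; apply: lerD; last by rewrite ler_pM2l ?exprn_gt0.
    by rewrite lerD2l lerN2 lerMn2r /= ler_pM2l.
  rewrite [in leRHS]exprMn ler_wpM2r ?sqr_ge0 // /q.
  (* [Num.sqrt] returns 0 on a negative radicand, and the inequality is then a comparison of
     signs. *)
  have [le0|ge0] := leP 0 (1 - (A / B) ^+ 2); first by rewrite sqr_sqrtr.
  by rewrite (le_trans (ltW ge0)) // sqr_ge0.
pose y i := iter i U f.
have yq i : nrm (y i) <= q ^+ i * nrm f.
  elim: i => [|i ih] /=; first by rewrite expr0 mul1r.
  by rewrite (le_trans (Uq _)) // exprS -mulrA ler_wpM2l.
have [L yL] : exists L, sums_to y L.
  apply: sums_to_complete => e e0.
  have [N hN] := geometric_small (nrm f / (1 - q)) q01 e0.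
  exists [fset i in iota 0 N]%fset => F dF.
  apply: le_lt_trans (hN N (leqnn _)).
  apply: (@le_trans _ _ (\sum_(i <- F) q ^+ i * nrm f)).
    by rewrite (le_trans (nrm_sum _ _ _)) // ler_sum.
  rewrite -mulr_suml mulrA mulrAC ler_wpM2r ?nrm_ge0 // ler_pdivlMr ?subr_gt0 // mulrC.
  pose M := \max_(i <- F) i.
  apply: le_trans (sum_geometric_le M.+1 N q01).
  rewrite ler_pM2l ?subr_gt0 //; apply: ler_sum_subset => [||i]; last 1 first.
    by rewrite exprn_ge0.
  - exact: fset_uniq.
  - move=> i iF; rewrite mem_iota.
    have -> : (N <= i)%N.
      rewrite leqNgt; apply/negP => iN.
      by move/fdisjointP: dF => /(_ i); rewrite !inE /= mem_iota iN iF => /(_ isT).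
    by rewrite ltn_addl // ltnS (leq_bigmax_seq i).
exists (inK tau *: L); apply/eqP; rewrite -subr_eq0; apply/eqP/nrm_eq0/eqP.
rewrite eq_le nrm_ge0 andbT; apply/ler_addgt0Pr => e e0; rewrite add0r.
have e1 : 0 < e / 2 / (tau * B) by rewrite !divr_gt0 // mulr_gt0.
have e2 : 0 < e / 2 by rewrite divr_gt0.
have [F0 hF0] := yL _ e1; have [N hN] := geometric_small (nrm f) q01 e2.
pose n := maxn N (\max_(i <- F0) i).+1.
pose P := \sum_(i <- iota 0 n) y i.
have hP : nrm (P - L) < e / 2 / (tau * B).
  have -> : P = \sum_(i <- [fset i in iota 0 n]%fset) y i.
    apply: perm_big; apply: uniq_perm; rewrite ?iota_uniq ?fset_uniq //.
    by move=> i; rewrite !inE.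
  apply: hF0; apply/fsubsetP => i iF; rewrite !inE /= mem_iota /= add0n.
  by rewrite /n leq_max ltnS (leq_bigmax_seq i) ?orbT.
have TD h g : T (h + g) = T h + T g.
  rewrite -[g in LHS]opprK TB -[X in T h - T X]sub0r TB -[X in T X - T g](subrr (0 : H)).
  by rewrite TB subrr sub0r opprK.
(* As y_(j+1) = y_j - tau T y_j, the partial sums telescope. *)
have TP : inK tau *: T P = f - y n.
  rewrite /P; elim: (n) => [|j ih].
    by rewrite big_nil -[in LHS](subrr (0 : H)) TB subrr scaler0 subrr.
  rewrite -[in iota _ _]addn1 iotaD big_cat /= big_seq1 add0n TD scalerDr ih.
  by rewrite /U opprB addrA addrAC.
rewrite TZ.
have -> : inK tau *: T L - f = inK tau *: T (L - P) - y n.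
  by rewrite TB scalerBr TP opprB addrCA [RHS]addrC addKr.
apply: le_trans (nrmB _ _) _; rewrite [e]splitr lerD //.
  rewrite nrmZ nrm_inK gtr0_norm //.
  apply: (@le_trans _ _ (tau * B * nrm (L - P))).
    by rewrite -mulrA ler_pM2l.
  by rewrite [leLHS]mulrC -ler_pdivlMr ?(mulr_gt0 tau0 B0) // nrm_distC ltW.
rewrite (le_trans (yq _)) // ltW // hN //.
by rewrite /n leq_maxl.
Qed.

(** * Power sums *)

(* If [A * a k.+1 > 2 * a k] for some [k], the recurrence propagates this to all
   later indices, and the bounded sequence [A ^+ k * a k] would grow linearly. *)
Lemma ratio_bound (R : realType) (a : nat -> R) (A C : R) : 0 < A ->
  (forall k, 0 <= a k) -> (forall k, A ^+ k * a k <= C) ->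
  (forall k, A * a k.+1 <= a k + A / 8 * a k.+1 + A ^+ 2 / 8 * a k.+2) ->
  forall k, A * a k.+1 <= 2 * a k.
Proof.
move=> A0 a0 aC arec k; pose c k := A ^+ k * a k.
have c0 i : 0 <= c i by rewrite mulr_ge0 ?exprn_ge0 // ltW.
have crec i : c i.+1 <= c i + c i.+1 / 8 + c i.+2 / 8.
  have := ler_wpM2l (exprn_ge0 i (ltW A0)) (arec i).
  by rewrite /c !exprS; congr (_ <= _); field.
suff : c k.+1 <= 2 * c k.
  by rewrite /c exprSr -mulrA [leRHS]mulrCA ler_pM2l ?exprn_gt0.
rewrite leNgt; apply/negP => ck.
have grow i : 2 * c (k + i)%N < c (k + i).+1.
  elim: i => [|i ih]; first by rewrite addn0.
  by rewrite addnS; have := crec (k + i)%N; have := c0 (k + i)%N; lra.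
have big i : i%:R * c k.+1 <= c (k + i).+1.
  elim: i => [|i ih]; first by rewrite mul0r.
  have := grow i; have := grow i.+1; rewrite addnS -natr1 mulrDl mul1r.
  have h : c k.+1 <= c (k + i).+1.
    elim: (i) => [|j hj]; first by rewrite addn0.
    by have := grow j.+1; rewrite addnS; have := c0 (k + j).+1; lra.
  by lra.
have ck0 : 0 < c k.+1 by have := c0 k; lra.
have := archi_boundP (divr_ge0 (le_trans (c0 0%N) (aC 0%N)) (ltW ck0)).
rewrite ltr_pdivrMr //.
have := big (Num.bound (C / c k.+1)).
by have := aC (k + Num.bound (C / c k.+1)).+1; rewrite -/(c _); lra.
Qed.

Section power_sums.
Context {R : realType}.
Implicit Types x y p : R.

Lemma powR_le x y p : 0 <= p -> 0 <= x <= y -> x `^ p <= y `^ p.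
Proof.
by move=> p0 /andP[x0 xy]; apply: ge0_ler_powR => //; rewrite nnegrE // (le_trans x0).
Qed.

Lemma powRN_le x y p : 0 <= p -> 0 < x <= y -> y `^ (- p) <= x `^ (- p).
Proof.
move=> p0 /andP[x0 xy]; rewrite !powRN lef_pV2 ?posrE ?powR_gt0 //.
  by rewrite powR_le // ltW.
exact: lt_le_trans xy.
Qed.

Lemma powR_add x p q : 0 < x -> x `^ (p + q) = x `^ p * x `^ q.
Proof. by move=> x0; rewrite powRD // (gt_eqF x0) implybT. Qed.

(* Convexity of [x `^ (1 - p)], in place of comparison with an integral. *)
Lemma powR_telescope x p : 0 < x -> 1 < p ->
  (p - 1) * (1 + x) `^ (- p) <= x `^ (1 - p) - (1 + x) `^ (1 - p).
Proof.
move=> x0 p1; have y0 : 0 < 1 + x by lra.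
have -> : x `^ (1 - p) = (1 + x) `^ (1 - p) * (x / (1 + x)) `^ (1 - p).
  by rewrite -powRM ?divr_ge0 ?ltW // mulrC divfK // gt_eqF.
have -> : (1 + x) `^ (- p) = (1 + x) `^ (1 - p) / (1 + x).
  by rewrite powR_add // powRr1 ?ltW // mulrAC divff ?mul1r // gt_eqF.
rewrite -[X in _ <= _ - X]mulr1 -mulrBr mulrCA ler_pM2l ?powR_gt0 // lerBrDl.
rewrite /powR gt_eqF ?divr_gt0 //.
apply: le_trans (expR_ge1Dx _); rewrite lerD2l.
have := @le_ln1Dx R (- (1 + x)^-1); rewrite ltrN2 invf_lt1 // ltrDl => /(_ x0).
have -> : 1 - (1 + x)^-1 = x / (1 + x) by field; rewrite gt_eqF.
by nra.
Qed.

Definition pw p (i : nat) : R := (1 + i%:R) `^ (- p).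

Lemma pw_ge0 p i : 0 <= pw p i.
Proof. exact: powR_ge0. Qed.

(** The terms are (1 + i)^-p with i >= N, so the telescoping starts at N^(1-p): the bound has N, not
    1 + N. *)
Lemma pw_tail p N n : 1 < p -> (0 < N)%N ->
  (p - 1) * \sum_(i <- iota N n) pw p i <= N%:R `^ (1 - p).
Proof.
move=> p1; elim: n N => [|n ih] N N0 /=.
  by rewrite big_nil mulr0 powR_ge0.
rewrite big_cons mulrDr /pw.
have := ih N.+1 isT; have := @powR_telescope N%:R p; rewrite ltr0n => /(_ N0 p1).
by rewrite -natr1 [N%:R + 1]addrC; lra.
Qed.

Lemma pw_sum1 p n : 1 < p -> \sum_(i <- iota 1 n) pw p i <= (p - 1)^-1.
Proof.
move=> p1; have := pw_tail n p1 (ltn0Sn 0); rewrite powR1 => h.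
by rewrite -ler_pdivlMl ?subr_gt0 // mulr1 in h.
Qed.

Lemma pw_sum0 p n : 1 < p -> \sum_(i <- iota 0 n) pw p i <= p / (p - 1).
Proof.
move=> p1; have -> : p / (p - 1) = 1 + (p - 1)^-1 by field; rewrite gt_eqF ?subr_gt0.
case: n => [|n] /=; first by rewrite big_nil addr_ge0 // invr_ge0 subr_ge0 ltW.
by rewrite big_cons lerD ?pw_sum1 // /pw addr0 powR1.
Qed.

Definition dist (i j : nat) : nat := ((i - j) + (j - i))%N.

Lemma distC i j : dist i j = dist j i.
Proof. exact: addnC. Qed.

Lemma pw_dist_sum p j n : 1 < p ->
  \sum_(l <- iota 0 n) pw p (dist j l) <= (p + 1) / (p - 1).
Proof.
(* Enlarging the range allows a split at j: distances 1 to j on the left, 0 to n - 1 on the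
   right. *)
move=> p1; apply: (@le_trans _ _ (\sum_(l <- iota 0 (j + n)) pw p (dist j l))).
  apply: ler_sum_subset => [||i]; [exact: iota_uniq| |exact: pw_ge0].
  by move=> i; rewrite !mem_iota /= !add0n => /ltn_addl ->.
have -> : (p + 1) / (p - 1) = (p - 1)^-1 + p / (p - 1).
  by field; rewrite gt_eqF ?subr_gt0.
rewrite iotaD big_cat /= add0n lerD //.
  apply: le_trans (pw_sum1 j p1).
  rewrite (_ : \sum_(l <- _) _ = \sum_(i <- [seq (j - l)%N | l <- iota 0 j]) pw p i).
    apply: ler_sum_subset => [||i]; [|move=> i|exact: pw_ge0].
      by rewrite map_inj_in_uniq ?iota_uniq // => x y; rewrite !mem_iota /=; lia.
    by move=> /mapP[l]; rewrite !mem_iota => lj ->; lia.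
  rewrite big_map !big_seq; apply: eq_bigr => l; rewrite mem_iota => lj.
  by congr pw; rewrite /dist; lia.
apply: le_trans (pw_sum0 n p1); rewrite -{1}[j]addn0 iotaDl big_map.
by under eq_bigr do rewrite /dist addKn -{1}[j]addn0 subnDl sub0n add0n.
Qed.

End power_sums.

(** * Kernels on pairs of indices *)

Section kernels.
Context {R : realType}.
Implicit Types F : {fset nat * nat}.

Lemma fset_box_bound F : exists M, forall j, j \in F -> (j.1 < M)%N /\ (j.2 < M)%N.
Proof.
exists (maxn (\max_(j <- F) j.1) (\max_(j <- F) j.2)).+1 => j jF.
by rewrite !ltnS !leq_max (leq_bigmax_seq j) // (leq_bigmax_seq j) // orbT.
Qed.

Lemma sum_prod_le F (a b : nat -> R) N1 N2 X Y :
  (forall i, 0 <= a i) -> (forall i, 0 <= b i) ->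
  (forall j, j \in F -> (N1 <= j.1)%N /\ (N2 <= j.2)%N) ->
  (forall n, \sum_(i <- iota N1 n) a i <= X) ->
  (forall n, \sum_(i <- iota N2 n) b i <= Y) ->
  \sum_(j <- F) a j.1 * b j.2 <= X * Y.
Proof.
move=> a0 b0 FN aX bY; have [M hM] := fset_box_bound F.
apply: (@le_trans _ _ (\sum_(j <- [seq (j1, j2) | j1 <- iota N1 M, j2 <- iota N2 M])
   a j.1 * b j.2)).
  apply: ler_sum_subset => [||i]; [exact: fset_uniq| |exact: mulr_ge0].
  move=> [j1 j2] jF; have /= [h1 h2] := hM _ jF; have /= [h3 h4] := FN _ jF.
  by apply/allpairsP; exists (j1, j2); rewrite !mem_iota h3 h4 !ltn_addl.
rewrite big_allpairs /=; under eq_bigr do rewrite -mulr_sumr.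
rewrite -mulr_suml ler_pM //; exact: sumr_ge0.
Qed.

(** Cauchy-Schwarz after splitting K into two square roots: the row sums give one factor Z and,
    after exchanging the sums, the column sums give the other. *)
Lemma schur_test (I : Type) (r r' : seq I) (K : I -> I -> R) (Z : R) (y : I -> R) :
  0 <= Z -> (forall j l, 0 <= K j l) ->
  (forall j, \sum_(l <- r') K j l <= Z) -> (forall l, \sum_(j <- r) K j l <= Z) ->
  \sum_(j <- r) (\sum_(l <- r') K j l * y l) ^+ 2 <= Z ^+ 2 * \sum_(l <- r') y l ^+ 2.
Proof.
move=> Z0 K0 KZ KZ'.
apply: (@le_trans _ _ (\sum_(j <- r) Z * \sum_(l <- r') K j l * y l ^+ 2)).
  apply: ler_sum => j _.
  have -> : \sum_(l <- r') K j l * y l =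
      \sum_(l <- r') Num.sqrt (K j l) * (Num.sqrt (K j l) * y l).
    by apply: eq_bigr => l _; rewrite mulrA -expr2 sqr_sqrtr.
  apply: le_trans (sum_CS _ _ _) _.
  under eq_bigr do rewrite sqr_sqrtr //.
  under [X in _ * X]eq_bigr do rewrite exprMn sqr_sqrtr //.
  by rewrite ler_wpM2r // sumr_ge0 // => l _; rewrite mulr_ge0 ?sqr_ge0.
rewrite -mulr_sumr expr2 -mulrA ler_wpM2l // exchange_big /= mulr_sumr.
apply: ler_sum => l _; rewrite -mulr_suml ler_wpM2r ?sqr_ge0 //.
Qed.

Lemma rank_one_test (I : Type) (r r' : seq I) (b : I -> R) (Z : R) (y : I -> R) :
  0 <= Z -> \sum_(j <- r) b j ^+ 2 <= Z -> \sum_(j <- r') b j ^+ 2 <= Z ->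
  \sum_(j <- r) (\sum_(l <- r') b j * b l * y l) ^+ 2 <= Z ^+ 2 * \sum_(l <- r') y l ^+ 2.
Proof.
move=> Z0 bZ bZ'.
have y0 : 0 <= \sum_(l <- r') y l ^+ 2 by rewrite sumr_ge0 // => l _; rewrite sqr_ge0.
apply: (@le_trans _ _ (\sum_(j <- r) b j ^+ 2 * (Z * \sum_(l <- r') y l ^+ 2))).
  apply: ler_sum => j _; under eq_bigr do rewrite -mulrA.
  rewrite -mulr_sumr exprMn ler_wpM2l ?sqr_ge0 // (le_trans (sum_CS _ _ _)) //.
  by rewrite ler_wpM2r.
by rewrite -mulr_suml expr2 -mulrA ler_wpM2r // mulr_ge0.
Qed.

Variable p : R.
Hypothesis p1 : 1 < p.

Definition conv_kernel (j l : nat * nat) : R :=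
  pw p (dist j.1 l.1) * pw p (dist j.2 l.2).

(** Square-summable over pairs since p > 1. Its plain sum may diverge, so the rank-one part of
    [kernel] escapes the Schur test and is handled by [rank_one_test]. *)
Definition decay (j : nat * nat) : R := Num.sqrt (pw p j.1 * pw p j.2).

Definition kernel (j l : nat * nat) : R := conv_kernel j l + decay j * decay l.

Let zeta := (p + 1) / (p - 1).

Lemma decay_sum F : \sum_(j <- F) decay j ^+ 2 <= zeta ^+ 2.
Proof.
under eq_bigr do rewrite sqr_sqrtr ?mulr_ge0 ?pw_ge0 //.
have h n : \sum_(i <- iota 0 n) pw p i <= zeta.
  apply: le_trans (pw_sum0 n p1) _.
  by rewrite ler_pM2r ?invr_gt0 ?subr_gt0 // lerDl.
by rewrite expr2 (@sum_prod_le F (pw p) (pw p) 0 0) //; exact: pw_ge0.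
Qed.

Lemma conv_kernel_ge0 j l : 0 <= conv_kernel j l.
Proof. by rewrite mulr_ge0 ?pw_ge0. Qed.

Lemma conv_kernel_sum F j : \sum_(l <- F) conv_kernel j l <= zeta ^+ 2.
Proof.
rewrite expr2 (@sum_prod_le F (fun i => pw p (dist j.1 i))
  (fun i => pw p (dist j.2 i)) 0 0) // => *; rewrite ?pw_ge0 ?pw_dist_sum //.
Qed.

Lemma kernel_test F F' (y : nat * nat -> R) :
  \sum_(j <- F) (\sum_(l <- F') kernel j l * y l) ^+ 2 <=
  (2 * zeta ^+ 2) ^+ 2 * \sum_(l <- F') y l ^+ 2.
Proof.
have z2 : 0 <= zeta ^+ 2 by rewrite sqr_ge0.
have h1 := @schur_test _ F F' conv_kernel _ y z2 conv_kernel_ge0 (conv_kernel_sum F').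
have h2 := @rank_one_test _ F F' decay _ y z2 (decay_sum F) (decay_sum F').
have {}h1 : \sum_(j <- F) (\sum_(l <- F') conv_kernel j l * y l) ^+ 2 <=
    (zeta ^+ 2) ^+ 2 * \sum_(l <- F') y l ^+ 2.
  apply: h1 => l; under eq_bigr do rewrite /conv_kernel distC [dist _ l.2]distC.
  exact: conv_kernel_sum.
apply: (@le_trans _ _ (\sum_(j <- F) (2 * (\sum_(l <- F') conv_kernel j l * y l) ^+ 2 +
   2 * (\sum_(l <- F') decay j * decay l * y l) ^+ 2))).
  apply: ler_sum => j _; under eq_bigr do rewrite mulrDl.
  rewrite big_split /=; set u := \sum_(l <- _) _; set v := \sum_(l <- _) _.
  by have := sqr_ge0 (u - v); nra.
rewrite big_split /= -!mulr_sumr exprMn.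
have -> : 2 ^+ 2 * (zeta ^+ 2) ^+ 2 * \sum_(l <- F') y l ^+ 2 =
   2 * ((zeta ^+ 2) ^+ 2 * \sum_(l <- F') y l ^+ 2) +
   2 * ((zeta ^+ 2) ^+ 2 * \sum_(l <- F') y l ^+ 2) by ring.
by rewrite lerD // ler_pM2l.
Qed.

End kernels.

(** * Weights and their commutator with a localized matrix *)

Section weights.
Context {R : realType}.

Definition maxnorm (j : nat * nat) : nat := maxn j.1 j.2.

Lemma le_maxnorm_norm2 (x y : R) : `|x| <= norm2 x y /\ `|y| <= norm2 x y.
Proof.
by split; rewrite -sqrtr_sqr ler_wsqrtr // ?lerDl ?lerDr sqr_ge0.
Qed.

Lemma dist_natr (i j : nat) : (dist i j)%:R = `|i%:R - j%:R| :> R.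
Proof.
have [ij|ji] := leqP i j.
  rewrite distrC ger0_norm ?subr_ge0 ?ler_nat // -natrB //; congr _%:R.
  by rewrite /dist; lia.
rewrite ger0_norm ?subr_ge0 ?ler_nat 1?ltnW // -natrB 1?ltnW //; congr _%:R.
by rewrite /dist; lia.
Qed.

Lemma dist_le_idx_dist (j l : nat * nat) :
  (dist j.1 l.1)%:R <= idx_dist R j l /\ (dist j.2 l.2)%:R <= idx_dist R j l.
Proof. by rewrite !dist_natr; exact: le_maxnorm_norm2. Qed.

Lemma maxnorm_le_idx_dist (j l : nat * nat) :
  `|(maxnorm j)%:R - (maxnorm l)%:R| <= idx_dist R j l.
Proof.
rewrite -dist_natr; have [h1 h2] := dist_le_idx_dist j l.
have : (dist (maxnorm j) (maxnorm l) <= maxn (dist j.1 l.1) (dist j.2 l.2))%N.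
  by rewrite /dist /maxnorm; lia.
rewrite -(ler_nat R) => h; apply: le_trans h _.
by rewrite maxnE; case: (leqP (dist j.2 l.2) (dist j.1 l.1)) => [|/ltnW] c;
   rewrite -maxnE ?(maxn_idPl c) ?(maxn_idPr c).
Qed.

Lemma idx_dist_ge0 j l : 0 <= idx_dist R j l.
Proof. exact: sqrtr_ge0. Qed.

Lemma maxnorm_le_idx_norm j : (maxnorm j)%:R <= idx_norm R j.
Proof.
have [h1 h2] := le_maxnorm_norm2 j.1%:R j.2%:R.
rewrite !normr_nat in h1 h2.
by rewrite /maxnorm; case: (leqP j.2 j.1) => [|/ltnW] c; rewrite ?(maxn_idPl c) ?(maxn_idPr c).
Qed.

Lemma maxnorm_gt0 j : N2 j -> 1 <= (maxnorm j)%:R :> R.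
Proof. by case=> h _; rewrite ler1n leq_max h. Qed.

(** A substitute for the mean value theorem. Passing from t to the integer T moves the power further
    from 1, on either side of 1; then x^(T+1) - 1 = x (x^T - 1) + (x - 1) with x <= 2 leads to 2 *
    3^T + 1 <= 3^(T+1). *)
Lemma norm_powR_sub1_le (x t : R) (T : nat) : 0 <= x <= 2 -> 1 <= t <= T%:R ->
  `|x `^ t - 1| <= 3 ^+ T * `|x - 1|.
Proof.
move=> /andP[x0 x2] /andP[t1 tT].
apply: (@le_trans _ _ `|x ^+ T - 1|).
  rewrite -powR_mulrn //.
  have [x1|x1] := leP 1 x.
    have h : 1 <= x `^ t.
      by rewrite (le_trans x1) // le1r_powR.
    have h' : x `^ t <= x `^ T%:R by exact: ler_powR.
    by rewrite !ger0_norm ?subr_ge0 ?(le_trans h) // lerD2r.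
  have [->|xn0] := eqVneq x 0.
    rewrite !powR0 // gt_eqF //; last by lra.
    by apply: lt_le_trans tT; lra.
  have xx : 0 < x by rewrite lt_neqAle eq_sym xn0.
  have h : x `^ t <= 1.
    by rewrite (le_trans _ (ltW x1)) // ge1r_powR // xx ltW.
  have h' : x `^ T%:R <= x `^ t by apply: ger_powR => //; rewrite xx ltW.
  by rewrite !ler0_norm ?subr_le0 ?(le_trans h') // lerN2 lerD2r.
elim: T {t1 tT} => [|T ih]; first by rewrite !expr0 subrr normr0 mul1r normr_ge0.
have -> : x ^+ T.+1 - 1 = x * (x ^+ T - 1) + (x - 1) by rewrite exprS; ring.
rewrite (le_trans (ler_normD _ _)) // normrM ger0_norm //.
have h3 : 1 <= 3 ^+ T :> R by rewrite exprn_ege1 //; lra.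
rewrite exprS.
have := normr_ge0 (x - 1); have := normr_ge0 (x ^+ T - 1).
by nra.
Qed.

Lemma le1_powR (x e : R) : 0 <= x <= 1 -> 0 < e <= 1 -> x <= x `^ e.
Proof.
move=> /andP[x0 x1] /andP[e0 e1]; have [->|xn0] := eqVneq x 0; first exact: powR_ge0.
by apply: ger1_powR => //; rewrite lt_neqAle eq_sym xn0 x0.
Qed.

(** The floor r keeps the relative variation of the weight small near the origin; the cap M keeps
    the weight bounded. *)
Definition clamp (r M x : R) : R := Num.min (Num.max x r) M.

Definition weight (r M t : R) (j : nat * nat) : R := clamp r M (maxnorm j)%:R `^ t.

Section clamp.
Variables r M : R.
Hypotheses (r1 : 1 <= r) (rM : r <= M).
Local Notation cl := (clamp r M).

Lemma clampP x : [\/ x <= r /\ cl x = r, [/\ r <= x, x <= M & cl x = x] |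
  [/\ r <= x, M <= x & cl x = M]].
Proof.
rewrite /clamp; have [xr|rx] := leP x r; first by apply: Or31; rewrite minEle rM.
have [xM|Mx] := leP x M; first by apply: Or32; split=> //; exact: ltW.
by apply: Or33; split=> //; exact: ltW.
Qed.

Lemma clamp_ge x : r <= cl x.
Proof. by have [[? ->]|[? ? ->]|[? ? ->]] := clampP x. Qed.

Lemma clamp_le x : cl x <= M.
Proof. by have [[? ->]|[? ? ->]|[? ? ->]] := clampP x. Qed.

Lemma clamp_lip x y : `|cl x - cl y| <= `|x - y|.
Proof.
have h1 := ler_norm (x - y); have h2 : y - x <= `|x - y| by rewrite distrC ler_norm.
have [h_r h_rM] := (r1, rM).
have [[? ->]|[? ? ->]|[? ? ->]] := clampP x;
  have [[? ->]|[? ? ->]|[? ? ->]] := clampP y;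
  rewrite ler_norml; apply/andP; split; lra.
Qed.

Lemma clamp_double x y : 0 <= y -> x <= 2 * y -> cl x <= 2 * cl y.
Proof.
move=> y0 xy; have [h_r h_rM] := (r1, rM).
have [[? ->]|[? ? ->]|[? ? ->]] := clampP x;
  have [[? ->]|[? ? ->]|[? ? ->]] := clampP y; lra.
Qed.

(** That is, clamp x / x is nonincreasing, in a product form that allows y = 0. It bounds a ratio of
    weights by a ratio of indices. *)
Lemma clamp_ratio x y : 0 <= y <= x -> r <= x -> cl x * y <= x * cl y.
Proof.
move=> /andP[y0 yx] rx; have [h_r h_rM] := (r1, rM).
have [[? ->]|[? ? ->]|[? ? ->]] := clampP x;
  have [[? ->]|[? ? ->]|[? ? ->]] := clampP y; nra.
Qed.

Lemma clamp_mono x y : x <= y -> cl x <= cl y.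
Proof.
move=> xy; have [h_r h_rM] := (r1, rM).
have [[? ->]|[? ? ->]|[? ? ->]] := clampP x;
  have [[? ->]|[? ? ->]|[? ? ->]] := clampP y; lra.
Qed.

Lemma clamp_le_mul x : 1 <= x -> cl x <= r * x.
Proof.
move=> x1; have [h_r h_rM] := (r1, rM).
by have [[? ->]|[? ? ->]|[? ? ->]] := clampP x => *; nra.
Qed.

Lemma weight_gt0 t j : 0 < weight r M t j.
Proof. by rewrite powR_gt0 // (lt_le_trans _ (clamp_ge _)) // (lt_le_trans _ r1). Qed.

Lemma weight_le t j : 0 <= t -> weight r M t j <= M `^ t.
Proof.
move=> t0; rewrite powR_le // clamp_le andbT.
by rewrite (le_trans _ (clamp_ge _)) // (le_trans _ r1).
Qed.

End clamp.

(** * Commutator of a weight with off-diagonal decay *)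

Section commutator_kernel.
Variables t eta : R.
Hypotheses (eta0 : 0 < eta) (eta1 : eta <= 1) (teta : 1 < t - eta).
Let p := t - eta.

Lemma decay_ge j : N2 j -> (maxnorm j)%:R `^ (- p) <= 2 `^ p * decay p j.
Proof.
move=> Nj; have J1 := maxnorm_gt0 Nj; set J := (maxnorm j)%:R in J1 *.
have p0 : 0 <= p by move: teta; rewrite -/p; lra.
have [h1 h2] : 1 + j.1%:R <= 2 * J /\ 1 + j.2%:R <= 2 * J.
  by split; (apply: (@le_trans _ _ (1 + J)); last by lra);
     rewrite lerD2l ler_nat leq_max leqnn ?orbT.
have e i : 1 + i%:R <= 2 * J -> 2 `^ (- p) * J `^ (- p) <= pw p i.
  by move=> h; rewrite -powRM // powRN_le // ltr_pwDl.
apply: (@le_trans _ _ (2 `^ p * (2 `^ (- p) * J `^ (- p)))).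
  by rewrite mulrA -powR_add // subrr powRr0 mul1r.
rewrite ler_wpM2l ?powR_ge0 // -ler_sqr ?nnegrE ?sqrtr_ge0 //; last first.
  by rewrite mulr_ge0 ?powR_ge0.
rewrite sqr_sqrtr ?mulr_ge0 ?pw_ge0 // expr2 ler_pM ?e //.
  by rewrite mulr_ge0 ?powR_ge0.
by rewrite mulr_ge0 ?powR_ge0.
Qed.

Lemma conv_kernel_ge j l :
  (1 + idx_dist R j l) `^ (- (2 * p)) <= conv_kernel p j l.
Proof.
have p0 : 0 <= p by move: teta; rewrite -/p; lra.
have x0 := idx_dist_ge0 j l; have [h1 h2] := dist_le_idx_dist j l.
have -> : - (2 * p) = - p + - p by ring.
rewrite powR_add ?ltr_pwDl // ler_pM ?powR_ge0 // powRN_le // ltr_pwDl //= lerD2l //.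
Qed.

(** Let x be the distance of j and l. If |j| <= 2 |l|, the relative variation of the weight is at
    most a multiple of ((1 + x) / r)^eta, paid out of the decay (1 + x)^(-2t). Otherwise 1 + x >=
    |j| / 2, and |j|^(-2t) absorbs the weight ratio (|j| / |l|)^t, leaving |j|^-t |l|^-t. *)
Lemma weight_commutator : exists2 D, 0 < D & forall r M, 1 <= r -> r <= M ->
  forall j l, N2 j -> N2 l ->
  `|weight r M t j - weight r M t l| * (1 + idx_dist R j l) `^ (- (2 * t)) <=
  D * r `^ (- eta) * (kernel p j l * weight r M t l).
Proof.
have [e0 e1] := (eta0, eta1).
have t1 : 1 < t by move: teta; lra.
have p1 : 1 < p := teta.
pose T := (Num.trunc t).+1.
have tT : t <= T%:R by rewrite ltW // /T truncnS_gt.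
pose D1 : R := 3 ^+ T; pose D2 : R := 2 `^ (2 * t) * (2 `^ p) ^+ 2.
have D10 : 0 < D1 by rewrite exprn_gt0.
have D20 : 0 < D2 by rewrite mulr_gt0 ?exprn_gt0 ?powR_gt0.
exists (D1 + D2) => [|r M r1 rM j l Nj Nl]; first exact: addr_gt0.
have J1 := maxnorm_gt0 Nj; have L1 := maxnorm_gt0 Nl.
have xJL := maxnorm_le_idx_dist j l.
have x0 := idx_dist_ge0 j l; set x := idx_dist R j l in xJL x0 *.
have cx : (1 + x) `^ (- (2 * p)) <= conv_kernel p j l := conv_kernel_ge j l.
have cd : 0 <= decay p j * decay p l by rewrite mulr_ge0 ?sqrtr_ge0.
have r0 : 0 < r by lra.
rewrite /weight.
set J := (maxnorm j)%:R in J1 xJL *; set L := (maxnorm l)%:R in L1 xJL *.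
set P := clamp r M J; set Q := clamp r M L.
have rQ : r <= Q := clamp_ge rM _. have rP : r <= P := clamp_ge rM _.
have Q0 : 0 < Q by lra. have P0 : 0 < P by lra.
have re0 : 0 < r `^ (- eta) by rewrite powR_gt0.
have Qt : 0 < Q `^ t by rewrite powR_gt0.
have ck0 : 0 <= conv_kernel p j l := conv_kernel_ge0 p j l.
have [JL|LJ] := leP J (2 * L).
  apply: (@le_trans _ _ (D1 * r `^ (- eta) * (conv_kernel p j l * Q `^ t))); last first.
    apply: ler_pM; [by rewrite !mulr_ge0 // ltW|by rewrite mulr_ge0 // ltW| |].
      by rewrite ler_wpM2r ?(ltW re0) // lerDl ltW.
    by rewrite ler_wpM2r ?(ltW Qt) // lerDl.
  have P2Q : P <= 2 * Q by apply: clamp_double => //; lra.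
  have PQx : `|P - Q| <= x by apply: le_trans (clamp_lip r1 rM _ _) xJL.
  have -> : P `^ t - Q `^ t = Q `^ t * ((P / Q) `^ t - 1).
    rewrite mulrBr mulr1 -powRM ?divr_ge0 ?(ltW Q0) ?(ltW P0) //.
    by rewrite mulrC divfK // gt_eqF.
  rewrite normrM (gtr0_norm Qt).
  have rho : 0 <= P / Q <= 2.
    by rewrite divr_ge0 ?(ltW Q0) ?(ltW P0) //= ler_pdivrMr.
  have hT : `|(P / Q) `^ t - 1| <= D1 * `|P / Q - 1|.
    by apply: norm_powR_sub1_le => //; rewrite (ltW t1).
  have z1 : `|P / Q - 1| <= 1.
    by rewrite ler_norml; case/andP: rho => *; apply/andP; split; lra.
  have zx : `|P / Q - 1| <= (1 + x) / r.
    have -> : P / Q - 1 = (P - Q) / Q by field; rewrite gt_eqF.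
    rewrite normrM normfV (gtr0_norm Q0) ler_pM ?invr_ge0 ?(ltW Q0) //; first by lra.
    by rewrite lef_pV2.
  (* A number in [0, 1] is at most its power eta, so the linear bound (1 + x) / r can be weakened to
     one that costs only (1 + x)^eta. *)
  have ze : `|P / Q - 1| <= (1 + x) `^ eta * r `^ (- eta).
    apply: (@le_trans _ _ (`|P / Q - 1| `^ eta)).
      by apply: le1_powR; rewrite ?normr_ge0 // eta0.
    apply: (@le_trans _ _ (((1 + x) / r) `^ eta)).
      by rewrite powR_le ?normr_ge0 // ltW.
    rewrite powRM ?invr_ge0 ?(ltW r0) //; last by lra.
    by rewrite -(powR_inv1 (ltW r0)) -powRrM mulN1r.
  apply: (@le_trans _ _ (Q `^ t * (D1 * ((1 + x) `^ eta * r `^ (- eta))) *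
      (1 + x) `^ (- (2 * t)))).
    rewrite ler_wpM2r ?powR_ge0 // ler_pM2l //; apply: le_trans hT _.
    by rewrite ler_pM2l.
  have -> : Q `^ t * (D1 * ((1 + x) `^ eta * r `^ (- eta))) * (1 + x) `^ (- (2 * t)) =
     D1 * r `^ (- eta) * ((1 + x) `^ eta * (1 + x) `^ (- (2 * t)) * Q `^ t) by ring.
  rewrite ler_pM2l ?mulr_gt0 // ler_pM2r //; apply: le_trans cx.
  (* The exponent eta - 2t is at most -2p = 2 eta - 2t. *)
  rewrite -powR_add ?ltr_pwDl //; apply: ler_powR; first by lra.
  by rewrite /p; lra.
(* If 2 |l| < |j| <= r, both indices lie under the floor and the weights agree. *)
have [Jr|rJ] := leP J r.
  have -> : P = r.
    rewrite /P; have [[_ ->]|[? ? ->]|[? ? ->]] := clampP rM J; lra.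
  have -> : Q = r.
    rewrite /Q; have [[_ ->]|[? ? ->]|[? ? ->]] := clampP rM L; lra.
  rewrite subrr normr0 mul0r !mulr_ge0 ?powR_ge0 ?addr_ge0 //; first exact: ltW.
  exact: ltW.
have PQ : P * L <= J * Q by apply: clamp_ratio => //; [apply/andP; split; lra|exact: ltW].
have Ptt : P `^ t <= Q `^ t * (J `^ t * L `^ (- t)).
  rewrite powRN mulrA ler_pdivlMr ?powR_gt0 //; last by lra.
  rewrite mulrC -!powRM ?(ltW P0) ?(ltW Q0) //; [|lra..].
  apply: powR_le; [lra|rewrite mulrC [Q * J]mulrC PQ andbT].
  by rewrite mulr_ge0 //; lra.
have ww : `|P `^ t - Q `^ t| <= P `^ t.
  have : Q `^ t <= P `^ t.
    by rewrite powR_le ?(ltW Q0) //=; [lra|apply: clamp_mono => //; lra].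
  by move=> h; rewrite ger0_norm ?subr_ge0 // lerBlDl lerDr ltW.
have xJ : J / 2 <= 1 + x.
  have := ler_norm (J - L); lra.
have xs : (1 + x) `^ (- (2 * t)) <= 2 `^ (2 * t) * (J `^ (- t) * J `^ (- t)).
  apply: (@le_trans _ _ ((J / 2) `^ (- (2 * t)))).
    by rewrite powRN_le ?xJ ?andbT //; [lra|rewrite divr_gt0 //; lra].
  rewrite powRM ?invr_ge0 //.
  rewrite -(powR_inv1 (ler0n R 2)) -powRrM mulN1r opprK mulrC -powR_add //; last by lra.
  by rewrite ler_pM2l ?powR_gt0 // le_eqVlt; apply/orP; left; apply/eqP; congr (_ `^ _); ring.
apply: (@le_trans _ _ (Q `^ t * (J `^ t * L `^ (- t)) *
   (2 `^ (2 * t) * (J `^ (- t) * J `^ (- t))))).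
  by rewrite ler_pM ?powR_ge0 ?normr_ge0 // (le_trans ww).
have Jt : J `^ t * J `^ (- t) = 1 by rewrite -powR_add ?subrr ?powRr0 //; lra.
have -> : Q `^ t * (J `^ t * L `^ (- t)) * (2 `^ (2 * t) * (J `^ (- t) * J `^ (- t))) =
   Q `^ t * L `^ (- t) * 2 `^ (2 * t) * J `^ (- t) * (J `^ t * J `^ (- t)) by ring.
rewrite Jt mulr1.
have hL : L `^ (- t) <= 2 `^ p * decay p l.
  apply: le_trans (decay_ge Nl); apply: ler_powR => //.
  by rewrite lerN2 /p; lra.
(* Since |j| > r, the part |j|^-eta of |j|^-t supplies the small factor. *)
have hJ : J `^ (- t) <= 2 `^ p * decay p j * r `^ (- eta).
  have -> : - t = - p + - eta by rewrite /p; ring.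
  rewrite powR_add; last by lra.
  by rewrite ler_pM ?powR_ge0 ?decay_ge // powRN_le ?(ltW eta0) // r0 ltW.
apply: (@le_trans _ _ (Q `^ t * (2 `^ p * decay p l) * 2 `^ (2 * t) *
   (2 `^ p * decay p j * r `^ (- eta)))).
  by rewrite ler_pM ?mulr_ge0 ?powR_ge0 ?(ltW Qt) // ler_wpM2r ?powR_ge0 // ler_pM2l.
have -> : Q `^ t * (2 `^ p * decay p l) * 2 `^ (2 * t) * (2 `^ p * decay p j * r `^ (- eta)) =
  D2 * r `^ (- eta) * (decay p j * decay p l * Q `^ t) by rewrite /D2; ring.
apply: ler_pM; [by rewrite !mulr_ge0 // ltW|by rewrite mulr_ge0 // ltW| |].
  by rewrite ler_wpM2r ?(ltW re0) // lerDr ltW.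
by rewrite ler_wpM2r ?(ltW Qt) // lerDr.
Qed.

End commutator_kernel.
End weights.

(** * Decay of the coefficients *)

Section l2_estimates.
Context {R : realType} {k : scalars}.
Local Notation K := (scal_field R k).

Lemma l2_le_sum (I : Type) (r : seq I) (x : I -> K) (b : I -> R) C :
  (forall i, nrm (x i) <= b i) -> 0 <= C -> \sum_(i <- r) b i ^+ 2 <= C ^+ 2 ->
  l2 r x <= C.
Proof.
move=> xb C0 bC; rewrite l2_le // (le_trans _ bC) //; apply: ler_sum => i _.
by rewrite ler_sqr ?nnegrE ?nrm_ge0 // (le_trans (nrm_ge0 (x i))).
Qed.

Lemma l2_le_scale (I : eqType) (r : seq I) (x y : I -> K) c : 0 <= c ->
  (forall i, i \in r -> nrm (x i) <= c * nrm (y i)) -> l2 r x <= c * l2 r y.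
Proof.
move=> c0 xy; rewrite l2_le ?mulr_ge0 ?l2_ge0 // exprMn sqr_l2 mulr_sumr.
rewrite big_seq [leRHS]big_seq; apply: ler_sum => i ir; rewrite -exprMn.
by rewrite ler_sqr ?nnegrE ?mulr_ge0 ?nrm_ge0 ?xy.
Qed.

(** One finite index set approximates the finitely many sums at once, so the uniform bound passes to
    the limits. *)
Lemma l2_sums_to (I : choiceType) (J : Type) (r : seq J) (z : J -> I -> K)
    (v : J -> K) C :
  (forall j, sums_to (z j) (v j)) ->
  (forall F : {fset I}, l2 r (fun j => \sum_(i <- F) z j i) <= C) ->
  l2 r v <= C.
Proof.
move=> zv zC; apply/ler_addgt0Pr => eps eps0.
have [F hF] : exists F0 : {fset I}, forall F, (F0 `<=` F)%fset ->
    l2 r (fun j => v j - \sum_(i <- F) z j i) <= eps.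
  elim: r {zC} eps eps0 => [|j r ih] eps eps0.
    by exists fset0 => F _; rewrite /l2 big_nil sqrtr0 ltW.
  have e20 : 0 < eps / 2 by rewrite divr_gt0.
  have [F1 h1] := ih _ e20; have [F2 h2] := zv j _ e20.
  exists (F1 `|` F2)%fset => F; rewrite fsubUset => /andP[/h1 {}h1 /h2 {}h2].
  rewrite l2_le ?(ltW eps0) // big_cons.
  have : l2 r (fun j => v j - \sum_(i <- F) z j i) ^+ 2 <= (eps / 2) ^+ 2.
    by rewrite ler_sqr ?nnegrE ?l2_ge0 // ltW.
  have : nrm (v j - \sum_(i <- F) z j i) ^+ 2 <= (eps / 2) ^+ 2.
    by rewrite ler_sqr ?nnegrE ?nrm_ge0 ?(ltW e20) // nrm_distC ltW.
  by rewrite sqr_l2; have := sqr_ge0 eps; lra.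
rewrite (eq_l2 _ (y := fun j => \sum_(i <- F) z j i + (v j - \sum_(i <- F) z j i))).
  by rewrite (le_trans (l2D _ _ _)) // lerD // hF.
by move=> j; rewrite addrC subrK.
Qed.

End l2_estimates.

(** * Weighted norms of the coefficients of S^-i f *)

Section localization.
Context {R : realType} {k : scalars}.
Local Notation K := (scal_field R k).
Variables (H : completeNormedModType K) (dot : {dot H for @sconj R k}).
Hypothesis dot_norm : induces_norm dot.
Variables (e : nat * nat -> H) (A B : R).
Hypotheses (A_gt0 : 0 < A) (B_gt0 : 0 < B).
Hypothesis bessel : forall (F : {fset nat * nat}) h,
  l2 F (coef dot e h) <= Num.sqrt B * nrm h.
Hypothesis lower : forall h c,
  (forall F : {fset nat * nat}, l2 F (coef dot e h) <= c) -> Num.sqrt A * nrm h <= c.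
Hypothesis e_out : forall j, ~ N2 j -> e j = 0.
Variables (gamma t eta D : R).
Hypotheses (gamma_gt0 : 0 < gamma) (eta_gt0 : 0 < eta).
Hypothesis t_eta : 1 < t - eta.
Hypothesis e_loc : forall j l, N2 j -> N2 l ->
  nrm (dot (e j) (e l)) <= gamma * (1 + idx_dist R j l) `^ (- (2 * t)).
Hypothesis D_gt0 : 0 < D.
Hypothesis weight_D : forall r M, 1 <= r -> r <= M -> forall j l, N2 j -> N2 l ->
  `|weight r M t j - weight r M t l| * (1 + idx_dist R j l) `^ (- (2 * t)) <=
  D * r `^ (- eta) * (kernel (t - eta) j l * weight r M t l).
Variable g : nat -> H.
Local Notation S := (frameop dot e).
Hypothesis gS : forall i, S (g i.+1) = g i.

Local Notation x i := (coef dot e (g i)).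
Let zeta := (t - eta + 1) / (t - eta - 1).
Local Notation frame_sums := (frameop_sums dot_norm B_gt0 bessel).

Let t_gt1 : 1 < t.
Proof. by move: t_eta eta_gt0; lra. Qed.

Section fixed_weight.
Variables r M : R.
Hypotheses (r1 : 1 <= r) (rM : r <= M).

Let w := weight r M t.
Definition wx i (j : nat * nat) : K := inK (w j) * x i j.
Let delta := gamma * D * r `^ (- eta) * (2 * zeta ^+ 2).

Let w_gt0 j : 0 < w j.
Proof. exact: weight_gt0. Qed.

Let Mt0 : 0 <= M `^ t.
Proof. exact: powR_ge0. Qed.

Lemma delta_ge0 : 0 <= delta.
Proof.
apply: mulr_ge0; last by rewrite mulr_ge0 // sqr_ge0.
by apply: mulr_ge0; [apply: mulr_ge0; exact: ltW|exact: powR_ge0].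
Qed.

Lemma l2_wx_le i (F : {fset nat * nat}) :
  l2 F (wx i) <= M `^ t * (Num.sqrt B * nrm (g i)).
Proof.
apply: (@le_trans _ _ (M `^ t * l2 F (x i))); last by rewrite ler_wpM2l.
apply: l2_le_scale => // j _; rewrite nrmM nrm_inK gtr0_norm //.
by rewrite ler_wpM2r ?nrm_ge0 // weight_le // ltW // (lt_trans _ t_gt1).
Qed.

Definition wnorm i : R := sup [set l2 F (wx i) | F in (setT : set {fset nat * nat})].

Let has_sup_wx i : has_sup [set l2 F (wx i) | F in (setT : set {fset nat * nat})].
Proof.
split; first by exists (l2 fset0 (wx i)), fset0.
by exists (M `^ t * (Num.sqrt B * nrm (g i))) => _ [F _ <-]; exact: l2_wx_le.
Qed.

Lemma l2_le_wnorm i (F : {fset nat * nat}) : l2 F (wx i) <= wnorm i.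
Proof. by apply: sup_upper_bound => //; exists F. Qed.

Lemma wnorm_le i C : (forall F : {fset nat * nat}, l2 F (wx i) <= C) -> wnorm i <= C.
Proof.
move=> wC; apply: ge_sup; first by have [] := has_sup_wx i.
by move=> _ [F _ <-].
Qed.

Lemma wnorm_ge0 i : 0 <= wnorm i.
Proof. exact: le_trans (l2_ge0 _ _) (l2_le_wnorm i fset0). Qed.

Lemma wsynthesis_ex i : exists l, sums_to (fun j => wx i j *: e j) l.
Proof. exact: (synthesis_cvg dot_norm B_gt0 bessel (l2_le_wnorm i)). Qed.

(** The vector whose coefficients G w x_i stand in for w x_(i-1), so that the lower frame bound can
    be applied. *)
Definition wsyn i : H := sval (cid (wsynthesis_ex i)).

Lemma wsyn_sums i : sums_to (fun j => wx i j *: e j) (wsyn i).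
Proof. by rewrite /wsyn; case: cid. Qed.

(* [x i] is the Gram matrix applied to [x i.+1] and [coef (wsyn i.+1)] the Gram
   matrix applied to [wx i.+1], so this is the commutator of the Gram matrix and
   the weight. *)
Definition defect i (j : nat * nat) : K := wx i j - coef dot e (wsyn i.+1) j.

Lemma defect_sums i j :
  sums_to (fun l => inK (w j - w l) * x i.+1 l * dot (e l) (e j)) (defect i j).
Proof.
have h1 := sums_to_dotl (e j) dot_norm (wsyn_sums i.+1).
have := sums_to_dotl (e j) dot_norm (frame_sums (g i.+1)).
rewrite gS => /(sums_toZ (V := K) (inK (w j))) h2.
apply: sums_to_eq (sums_toB h2 h1) => l /=.
by rewrite !dotZl /wx rmorphB /= !mulrBl -!mulrA.
Qed.

(** By [e_loc] and [weight_D], the commutator is dominated entrywise by a multiple of [kernel]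
    acting on the norms of [wx i.+1]; [kernel_test] gives its norm. The factor r^-eta is what makes
    delta small. *)
Lemma l2_defect_le i (F : {fset nat * nat}) : l2 F (defect i) <= delta * wnorm i.+1.
Proof.
apply: (l2_sums_to (defect_sums i)) => F'.
pose c := gamma * D * r `^ (- eta).
have c0 : 0 <= c.
  by apply: mulr_ge0; [apply: mulr_ge0; exact: ltW|exact: powR_ge0].
pose b j := c * \sum_(l <- F') kernel (t - eta) j l * nrm (wx i.+1 l).
apply: (@l2_le_sum _ _ _ _ _ b) => [j||].
- rewrite (le_trans (nrm_sum _ _ _)) // /b mulr_sumr; apply: ler_sum => l _.
  have rhs0 : 0 <= c * (kernel (t - eta) j l * nrm (wx i.+1 l)).
    rewrite mulr_ge0 // mulr_ge0 ?nrm_ge0 // addr_ge0 ?conv_kernel_ge0 //.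
    by rewrite mulr_ge0 ?sqrtr_ge0.
  have [Nj|/e_out ej] := pselect (N2 j); last by rewrite ej dot0r mulr0 nrm0.
  have [Nl|/e_out el] := pselect (N2 l); last by rewrite el dot0l mulr0 nrm0.
  rewrite !nrmM !nrm_inK (gtr0_norm (w_gt0 l)) [nrm (dot (e l) _)]nrm_dotC.
  have xl := nrm_ge0 (x i.+1 l).
  apply: (@le_trans _ _ (`|w j - w l| * nrm (x i.+1 l) *
      (gamma * (1 + idx_dist R j l) `^ (- (2 * t))))).
    by rewrite ler_wpM2l ?mulr_ge0 ?nrm_ge0 // e_loc.
  have := ler_wpM2l (mulr_ge0 xl (ltW gamma_gt0)) (weight_D r1 rM Nj Nl).
  by rewrite -/w /c; congr (_ <= _); ring.
- exact: mulr_ge0 delta_ge0 (wnorm_ge0 _).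
- under eq_bigr do rewrite /b exprMn.
  rewrite -mulr_sumr /delta -/c.
  have -> : (c * (2 * zeta ^+ 2) * wnorm i.+1) ^+ 2 =
    c ^+ 2 * ((2 * zeta ^+ 2) ^+ 2 * wnorm i.+1 ^+ 2) by ring.
  rewrite ler_wpM2l ?sqr_ge0 //.
  apply: le_trans (kernel_test t_eta F F' (fun l => nrm (wx i.+1 l))) _.
  by rewrite ler_wpM2l ?sqr_ge0 // -sqr_l2 ler_sqr ?nnegrE ?l2_ge0 ?wnorm_ge0 ?l2_le_wnorm.
Qed.

Local Notation b i := (energy dot e (wsyn i)).

Lemma wnorm_le_energy i : wnorm i <= b i.+1 + delta * wnorm i.+1.
Proof.
apply: wnorm_le => F.
rewrite (eq_l2 _ (y := fun j => coef dot e (wsyn i.+1) j + defect i j)).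
  by rewrite (le_trans (l2D _ _ _)) // lerD ?(l2_le_energy dot_norm B_gt0 bessel) ?l2_defect_le.
by move=> j; rewrite /defect addrC subrK.
Qed.

Lemma energy_le_wnorm i : b i.+1 <= wnorm i + delta * wnorm i.+1.
Proof.
apply: (energy_le dot_norm B_gt0 bessel) => [|F].
  by apply: addr_ge0; [exact: wnorm_ge0|exact: mulr_ge0 delta_ge0 (wnorm_ge0 _)].
rewrite (eq_l2 _ (y := fun j => wx i j - defect i j)).
  by rewrite (le_trans (l2B _ _ _)) // lerD ?l2_le_wnorm ?l2_defect_le.
by move=> j; rewrite /defect subKr.
Qed.

(** [wsyn i.+1] synthesizes [wx i.+1] and [S (wsyn i.+2)] synthesizes [coef (wsyn i.+2)], so their
    difference synthesizes the defect. Synthesis and energy each cost a factor sqrt B. *)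
Lemma energy_step i : A * b i.+2 <= b i.+1 + B * delta * wnorm i.+2.
Proof.
apply: le_trans (energy_frameop dot_norm B_gt0 bessel A_gt0 lower _) _.
have -> : S (wsyn i.+2) = wsyn i.+1 + (S (wsyn i.+2) - wsyn i.+1) by rewrite addrC subrK.
rewrite (le_trans (energyD dot_norm B_gt0 bessel _ _)) // lerD2l.
rewrite (le_trans (energy_le_nrm dot_norm B_gt0 bessel _)) //.
have -> : B * delta * wnorm i.+2 = Num.sqrt B * (Num.sqrt B * (delta * wnorm i.+2)).
  by rewrite -{1}(sqr_sqrtr (ltW B_gt0)); ring.
rewrite ler_wpM2l ?sqrtr_ge0 //.
have := sums_toB (wsyn_sums i.+1) (frame_sums (wsyn i.+2)).
rewrite nrm_distC => /sums_to_le; apply => F.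
rewrite (_ : \sum_(j <- F) _ = \sum_(j <- F) defect i.+1 j *: e j); last first.
  by apply: eq_bigr => j _; rewrite scalerBl.
rewrite (le_trans (synthesis_le dot_norm bessel _ _)) // ler_wpM2l ?sqrtr_ge0 //.
exact: l2_defect_le.
Qed.

(** Three comparisons in a chain: from a_(i+1) to the energy of [wsyn i.+2], down one index by
    [energy_step], then back to a_i. *)
Lemma wnorm_step : delta <= A / 8 -> (A + B) * delta <= A ^+ 2 / 8 ->
  forall i, A * wnorm i.+1 <= wnorm i + A / 8 * wnorm i.+1 + A ^+ 2 / 8 * wnorm i.+2.
Proof.
move=> d1 d2 i.
have h1 := ler_wpM2l (ltW A_gt0) (wnorm_le_energy i.+1).
have h2 := energy_step i; have h3 := energy_le_wnorm i.
have h4 := ler_wpM2r (wnorm_ge0 i.+1) d1.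
have h5 := ler_wpM2r (wnorm_ge0 i.+2) d2.
by lra.
Qed.

Lemma nrm_g_le i : A ^+ i * nrm (g i) <= nrm (g 0).
Proof.
elim: i => [|i ih]; first by rewrite mul1r.
apply: le_trans ih; rewrite exprSr -mulrA ler_wpM2l ?exprn_ge0 ?(ltW A_gt0) //.
by rewrite -[in leRHS]gS (frameop_ge dot_norm B_gt0 bessel A_gt0 lower).
Qed.

(** The bound on A^i a_i depends on M, but [ratio_bound] uses only its existence, so the resulting
    ratio 2 / A is the same for all M. *)
Lemma wnorm_ratio : delta <= A / 8 -> (A + B) * delta <= A ^+ 2 / 8 ->
  forall i, A * wnorm i.+1 <= 2 * wnorm i.
Proof.
move=> d1 d2.
apply: (@ratio_bound _ wnorm A (M `^ t * (Num.sqrt B * nrm (g 0)))) => //.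
- exact: wnorm_ge0.
- move=> i; apply: (@le_trans _ _ (A ^+ i * (M `^ t * (Num.sqrt B * nrm (g i))))).
    rewrite ler_wpM2l ?exprn_ge0 ?(ltW A_gt0) //.
    by apply: wnorm_le => F; exact: l2_wx_le.
  rewrite mulrCA [A ^+ i * _]mulrCA ler_wpM2l // ler_wpM2l ?sqrtr_ge0 //.
  exact: nrm_g_le.
- exact: wnorm_step.
Qed.

End fixed_weight.

Lemma small_delta : exists2 r, 1 <= r &
  let delta := gamma * D * r `^ (- eta) * (2 * zeta ^+ 2) in
  delta <= A / 8 /\ (A + B) * delta <= A ^+ 2 / 8.
Proof.
have p1 : 0 < t - eta - 1 by rewrite subr_gt0.
have z0 : 0 < zeta by rewrite /zeta divr_gt0 //; move: t_eta; lra.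
pose E := gamma * D * (2 * zeta ^+ 2).
have E0 : 0 < E by apply: mulr_gt0; [exact: mulr_gt0|rewrite mulr_gt0 // exprn_gt0].
have AB : 0 < A + B by rewrite addr_gt0.
pose m := Num.min (A / 8) (A ^+ 2 / 8 / (A + B)).
have m0 : 0 < m by rewrite lt_min !divr_gt0 ?exprn_gt0.
(* The power solves E r^-eta = m; the added 1 secures 1 <= r. *)
exists (1 + (E / m) `^ eta^-1); first by rewrite lerDl powR_ge0.
set r := 1 + _; move=> delta.
have r0 : 0 < (E / m) `^ eta^-1 by rewrite powR_gt0 // divr_gt0.
have dm : delta <= m.
  have -> : delta = E * r `^ (- eta) by rewrite /delta /E; ring.
  apply: (@le_trans _ _ (E * ((E / m) `^ eta^-1) `^ (- eta))).
    by rewrite ler_pM2l // powRN_le ?(ltW eta_gt0) // r0 /r lerDr ler01.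
  rewrite powRN -powRrM mulVf ?gt_eqF // powRr1 ?divr_ge0 ?(ltW E0) ?(ltW m0) //.
  by rewrite invf_div mulrCA divff ?mulr1 // gt_eqF.
split; first by apply: le_trans dm _; rewrite ge_min lexx.
rewrite mulrC -ler_pdivlMr //; apply: le_trans dm _.
by rewrite ge_min lexx orbT.
Qed.

Lemma coef_tail c0 : 0 < c0 ->
  (forall j, N2 j -> nrm (x 0 j) <= c0 * (maxnorm j)%:R `^ (- (2 * t))) ->
  exists2 C, 0 < C & forall i n (F : {fset nat * nat}), (0 < n)%N -> (i <= 2)%N ->
    (forall j, j \in F -> (n <= maxnorm j)%N) -> l2 F (x i) <= C * n%:R `^ (- t).
Proof.
move=> c00 x0; have [r r1 [d1 d2]] := small_delta.
have p1 : 0 < t - eta - 1 by rewrite subr_gt0.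
have z0 : 0 < zeta by rewrite /zeta divr_gt0 //; move: t_eta; lra.
have r0 : 0 < r by exact: lt_le_trans r1.
pose c := r `^ t * c0 * 2 `^ (t - eta).
have cc : 0 < c by rewrite !mulr_gt0 // powR_gt0.
(* Uniform in M: the weight is at most (r |j|)^t, so the decay |j|^(-2t) leaves |j|^-t, which is
   square-summable. *)
have w0 M : r <= M -> wnorm r M 0 <= c * zeta.
  move=> rM; apply: wnorm_le => // F.
  apply: (@l2_le_sum _ _ _ _ _ (fun j => c * decay (t - eta) j)) => [j||].
  - rewrite nrmM nrm_inK gtr0_norm ?weight_gt0 //.
    have [Nj|/e_out ej] := pselect (N2 j); last first.
      by rewrite /coef ej dot0r nrm0 mulr0 mulr_ge0 ?sqrtr_ge0 ?ltW.
    have J1 := @maxnorm_gt0 R _ Nj; set J := (maxnorm j)%:R in J1 *.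
    have J0 : 0 < J by exact: lt_le_trans J1.
    apply: (@le_trans _ _ ((r `^ t * J `^ t) * (c0 * J `^ (- (2 * t))))).
      apply: ler_pM; rewrite ?powR_ge0 ?nrm_ge0 ?x0 //.
      rewrite -powRM ?(ltW r0) ?(ltW J0) // powR_le //.
        by rewrite ltW // (lt_trans _ t_gt1).
      rewrite clamp_le_mul // andbT (le_trans (ltW r0)) //; exact: clamp_ge.
    have -> : r `^ t * J `^ t * (c0 * J `^ (- (2 * t))) = r `^ t * c0 * J `^ (- t).
      have -> : - t = t + - (2 * t) by ring.
      by rewrite powR_add //; ring.
    rewrite /c -[leRHS]mulrA ler_pM2l ?mulr_gt0 ?powR_gt0 //.
    apply: le_trans (decay_ge t_eta Nj).
    by apply: ler_powR => //; rewrite lerN2 gerBl ltW.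
  - by rewrite mulr_ge0 ?ltW.
  - have -> : (c * zeta) ^+ 2 = c ^+ 2 * zeta ^+ 2 by ring.
    rewrite (eq_bigr (fun j => c ^+ 2 * decay (t - eta) j ^+ 2)); last first.
      by move=> j _; ring.
    by rewrite -mulr_sumr ler_wpM2l ?sqr_ge0 // decay_sum.
(* q exceeds both 1 and 2 / A, so q^i bounds the i-fold ratio and q^2 covers all i <= 2. *)
pose q := 1 + 2 / A.
have q1 : 1 <= q by rewrite lerDl divr_ge0 // ltW.
exists (q ^+ 2 * (c * zeta)) => [|i n F n0 i2 Fn].
  by apply: mulr_gt0; [rewrite exprn_gt0 // (lt_le_trans ltr01)|exact: mulr_gt0].
have [M' hM'] := fset_box_bound F.
(* The cap is chosen after F, above all its indices, so that on F the weight is at least n^t. *)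
pose M := r + M'%:R.
have rM : r <= M by rewrite lerDl.
have wi : wnorm r M i <= q ^+ 2 * (c * zeta).
  apply: (@le_trans _ _ (q ^+ i * wnorm r M 0)); last first.
    rewrite ler_pM ?exprn_ge0 ?wnorm_ge0 ?w0 //; first exact: le_trans q1.
    by rewrite ler_weXn2l.
  elim: i {i2} => [|i ih]; first by rewrite mul1r.
  rewrite exprS -mulrA; apply: (@le_trans _ _ (q * wnorm r M i)); last first.
    by rewrite ler_wpM2l // (le_trans ler01).
  have := @wnorm_ratio r M r1 rM d1 d2 i; have := wnorm_ge0 r1 rM i => h h'.
  rewrite -(ler_pM2l A_gt0); apply: le_trans h' _; rewrite mulrA ler_wpM2r //.
  by rewrite mulrDr mulr1 mulrCA divff ?gt_eqF // mulr1 lerDr ltW.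
have nt : 0 < n%:R `^ t :> R by rewrite powR_gt0 // ltr0n.
apply: (@le_trans _ _ (n%:R `^ (- t) * wnorm r M i)); last first.
  by rewrite mulrC ler_wpM2r ?powR_ge0.
apply: (@le_trans _ _ (n%:R `^ (- t) * l2 F (wx r M i))); last first.
  by rewrite ler_wpM2l ?powR_ge0 // l2_le_wnorm.
apply: l2_le_scale => [|j jF]; first exact: powR_ge0.
rewrite nrmM nrm_inK gtr0_norm ?weight_gt0 // mulrA -[leLHS]mul1r.
rewrite ler_wpM2r ?nrm_ge0 // powRN mulrC ler_pdivlMr // mul1r.
apply: powR_le; first by rewrite ltW // (lt_trans _ t_gt1).
rewrite ler0n /= /clamp le_min le_max ler_nat Fn //=.
have [] := hM' _ jF => h1 h2; rewrite /M (@le_trans _ _ M'%:R) //; last by rewrite lerDr ltW.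
by rewrite ler_nat (leq_trans (Fn _ jF)) // /maxnorm geq_max (ltnW h1) (ltnW h2).
Qed.

End localization.

(** * The smallest eigenvalue of a positive definite matrix *)

Section rayleigh.
Context {R : realType} {k : scalars}.
Local Notation K := (scal_field R k).
Variable p : nat.
Implicit Types (u v w : 'rV[K]_p) (N M : 'M[K]_p).

Definition sqnorm v : R := \sum_a nrm (v 0 a) ^+ 2.

(** The form u N w^*, in the row-vector convention of [eigenvalue]. *)
Definition mxform N u w : K := \sum_b (u *m N) 0 b * sconj (w 0 b).

Definition mxherm N := forall a b, N a b = sconj (N b a).

Lemma sqnorm_ge0 v : 0 <= sqnorm v.
Proof. by apply: sumr_ge0 => a _; exact: sqr_ge0. Qed.

Lemma sqnorm_gt0 v : v != 0 -> 0 < sqnorm v.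
Proof.
move=> v0; rewrite lt_neqAle sqnorm_ge0 andbT eq_sym; apply: contra_neq v0.
move=> /eqP; rewrite psumr_eq0 => [/allP h|a _]; last exact: sqr_ge0.
apply/rowP => a; rewrite mxE; apply: nrm_eq0; apply/eqP; rewrite -sqrf_eq0.
by apply: h; rewrite mem_index_enum.
Qed.

Lemma mxformBl N u v w : mxform N (u - v) w = mxform N u w - mxform N v w.
Proof.
by rewrite -sumrB; apply: eq_bigr => b _; rewrite mulmxBl !mxE mulrBl.
Qed.

Lemma mxformZl N a u w : mxform N (a *: u) w = a * mxform N u w.
Proof.
by rewrite mulr_sumr; apply: eq_bigr => b _; rewrite -scalemxAl !mxE mulrA.
Qed.

Lemma sconj_sum I (r : seq I) (F : I -> K) :
  sconj (\sum_(i <- r) F i) = \sum_(i <- r) sconj (F i).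
Proof.
elim: r => [|i r ih]; last by rewrite !big_cons sconjD ih.
by rewrite !big_nil -[0 in LHS](rmorph0 inK) sconj_inK rmorph0.
Qed.

Lemma sconjM (a b : K) : sconj (a * b) = sconj a * sconj b.
Proof. by rewrite /sconj; case: k a b => //= a b; rewrite rmorphM. Qed.

Lemma mxform_herm N u w : mxherm N -> mxform N u w = sconj (mxform N w u).
Proof.
move=> hN; rewrite /mxform sconj_sum.
under eq_bigr do rewrite mxE mulr_suml.
rewrite exchange_big /=; apply: eq_bigr => a _.
rewrite sconjM sconjK mxE sconj_sum mulr_suml; apply: eq_bigr => b _.
by rewrite sconjM -hN [LHS]mulrAC -mulrA mulrC.
Qed.

Lemma mxform_mul N v : mxform N v (v *m N) = inK (sqnorm (v *m N)).
Proof. by rewrite rmorph_sum; apply: eq_bigr => b _; rewrite mul_sconj. Qed.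

Lemma sqnorm_mul_le N v :
  sqnorm (v *m N) <= sqnorm v * \sum_b \sum_a nrm (N a b) ^+ 2.
Proof.
rewrite mulr_sumr; apply: ler_sum => b _; apply: le_trans (sum_CS _ _ _).
rewrite ler_sqr ?nnegrE ?nrm_ge0 //; last first.
  by apply: sumr_ge0 => a _; rewrite mulr_ge0 ?nrm_ge0.
rewrite mxE (le_trans (nrm_sum _ _ _)) //; apply: ler_sum => a _.
by rewrite nrmM.
Qed.

Lemma mxform_le N v :
  sre (mxform N v v) <= (1 + \sum_b \sum_a nrm (N a b) ^+ 2) * sqnorm v.
Proof.
rewrite (le_trans (sre_le_nrm _)) // (le_trans (nrm_sum _ _ _)) //.
apply: (@le_trans _ _ (\sum_b (nrm ((v *m N) 0 b) ^+ 2 + nrm (v 0 b) ^+ 2))).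
  apply: ler_sum => b _; rewrite nrmM nrm_sconj.
  by have := nrm_ge0 ((v *m N) 0 b); have := nrm_ge0 (v 0 b); nra.
rewrite big_split /= mulrDl mul1r addrC lerD // mulrC.
exact: sqnorm_mul_le.
Qed.

(* Evaluate the form at [v - (v *m N) / L], with [L] a bound on [N]. *)
Lemma psd_unit_coercive N : mxherm N -> (forall v, 0 <= sre (mxform N v v)) ->
  N \in unitmx -> exists2 eps : R, 0 < eps & forall v, eps * sqnorm v <= sre (mxform N v v).
Proof.
move=> hN psd uN; pose fro (P : 'M[K]_p) := 1 + \sum_b \sum_a nrm (P a b) ^+ 2.
have fro0 P : 0 < fro P.
  by rewrite ltr_pwDl // !sumr_ge0 // => b _; rewrite sumr_ge0 // => a _; exact: sqr_ge0.
exists (fro N * fro (invmx N))^-1 => [|v]; first by rewrite invr_gt0 mulr_gt0.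
have low : (fro N)^-1 * sqnorm (v *m N) <= sre (mxform N v v).
  have := psd (v - inK (fro N)^-1 *: (v *m N)).
  rewrite !mxformBl !mxformZl [mxform N v (_ - _)]mxform_herm //.
  rewrite [mxform N (v *m N) (_ - _)]mxform_herm // !mxformBl !mxformZl.
  rewrite [mxform N (v *m N) v]mxform_herm // mxform_mul sconj_inK.
  rewrite raddfB /= sre_mul_inK !sre_sconj !raddfB /= !sre_mul_inK inKK.
  have := mxform_le N (v *m N); rewrite -/(fro N) => h.
  have i0 : 0 < (fro N)^-1 by rewrite invr_gt0.
  have := ler_wpM2l (ltW (mulr_gt0 i0 i0)) h.
  rewrite mulrA mulfVK ?gt_eqF //; lra.
apply: le_trans low; rewrite invfM -mulrA ler_pM2l ?invr_gt0 // ler_pdivrMl //.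
rewrite -[in leLHS](mulmxK uN v) (le_trans (sqnorm_mul_le _ _)) // mulrC.
by rewrite ler_wpM2r ?sqnorm_ge0 // lerDr.
Qed.

Lemma mxform_shift N v (c : R) :
  sre (mxform (N - (inK c)%:M) v v) = sre (mxform N v v) - c * sqnorm v.
Proof.
have -> : mxform (N - (inK c)%:M) v v = mxform N v v - inK (c * sqnorm v).
  rewrite rmorphM rmorph_sum mulr_sumr -sumrB; apply: eq_bigr => b _.
  by rewrite mulmxBr mul_mx_scalar !mxE mulrBl -mulrA mul_sconj.
by rewrite raddfB /= inKK.
Qed.

Lemma mxherm_shift N (c : R) : mxherm N -> mxherm (N - (inK c)%:M).
Proof.
move=> hN a b; rewrite !mxE [b == a]eq_sym [N a b]hN.
have sB (x y : K) : sconj (x - y) = sconj x - sconj y.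
  by apply/eqP; rewrite eq_sym subr_eq -sconjD subrK.
rewrite sB; case: (a == b); rewrite ?mulr1n ?mulr0n ?sconj_inK //.
by rewrite -(rmorph0 inK) sconj_inK.
Qed.

Hypothesis p_gt0 : (0 < p)%N.

(** Let mu be the infimum of the Rayleigh quotient. Then M - mu is positive semidefinite; were it
    invertible, it would be coercive and mu could be raised. Hence mu is an eigenvalue, and the
    least one since every eigenvalue is a Rayleigh quotient. Neither compactness of the sphere nor
    diagonalization is involved. *)
Lemma lambda_min_coercive M : mxherm M -> (forall v, 0 <= sre (mxform M v v)) ->
  M \in unitmx ->
  0 < lambda_min M /\ forall v, lambda_min M * sqnorm v <= sre (mxform M v v).
Proof.
move=> hM psd uM.
pose ray := [set sre (mxform M v v) / sqnorm v | v in [set v | v != 0]].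
have [v1 v10] : exists v : 'rV[K]_p, v != 0.
  exists (const_mx 1); apply/eqP => /rowP /(_ (Ordinal p_gt0)) /eqP.
  by rewrite !mxE oner_eq0.
have ray0 : has_inf ray.
  split; first by exists (sre (mxform M v1 v1) / sqnorm v1), v1.
  by exists 0 => _ [v _ <-]; rewrite divr_ge0 ?psd ?sqnorm_ge0.
have muP v : inf ray * sqnorm v <= sre (mxform M v v).
  have [->|v0] := eqVneq v 0.
    rewrite /sqnorm big1 ?mulr0 // => a _.
    by rewrite mxE nrm0 expr0n.
  by rewrite -ler_pdivlMr ?sqnorm_gt0 //; apply: inf_lbound => //; [case: ray0|exists v].
have ray_ge c : (forall v, c * sqnorm v <= sre (mxform M v v)) -> c <= inf ray.
  move=> cP; apply: lb_le_inf; first by case: ray0.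
  by move=> _ [v /= v0 <-]; rewrite ler_pdivlMr ?sqnorm_gt0.
have [eps eps0 epsP] := psd_unit_coercive hM psd uM.
have mu0 : 0 < inf ray := lt_le_trans eps0 (ray_ge _ epsP).
have ev : eigenvalue M (inK (inf ray)).
  pose N := M - (inK (inf ray))%:M.
  have : N \notin unitmx.
    apply/negP => uN.
    have psdN v : 0 <= sre (mxform N v v) by rewrite mxform_shift subr_ge0.
    have [d d0 dP] := psd_unit_coercive (mxherm_shift _ hM) psdN uN.
    have : inf ray + d <= inf ray.
      apply: ray_ge => v; have := dP v; rewrite mxform_shift mulrDl; lra.
    by rewrite gerDl leNgt d0.
  rewrite unitmxE unitfE negbK => /det0P[v v0 vN]; apply/eigenvalueP; exists v => //.
  by apply/eqP; rewrite -subr_eq0 -mul_mx_scalar -mulmxBr vN.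
have lamE : lambda_min M = inf ray.
  have lb : lbound [set sre a | a in [set a | eigenvalue M a]] (inf ray).
    move=> _ [a /eigenvalueP[v va v0] <-].
    have := muP v; have -> : mxform M v v = a * inK (sqnorm v).
      rewrite /mxform va rmorph_sum mulr_sumr; apply: eq_bigr => b _.
      by rewrite mxE -mulrA mul_sconj.
    by rewrite [a * _]mulrC sre_mul_inK [sqnorm v * _]mulrC ler_pM2r // sqnorm_gt0.
  apply/eqP; rewrite eq_le; apply/andP; split.
    by apply: inf_lbound; [exists (inf ray)|exists (inK (inf ray)); rewrite ?inKK].
  by apply: lb_le_inf => //; exists (inf ray), (inK (inf ray)); rewrite ?inKK.
by rewrite lamE.
Qed.

End rayleigh.

(** * Finite sections *)

Section frame_to_l2.
Context {R : realType} {k : scalars}.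
Local Notation K := (scal_field R k).
Variables (H : completeNormedModType K) (dot : {dot H for @sconj R k}).
Variable (psi : nat * nat -> H).

(* Extending the family by [0] outside [N2] turns sums over [N2] into sums over
   all pairs. *)
Definition mask (j : nat * nat) : H := if j \in N2 then psi j else 0.

Lemma mask_in j : N2 j -> mask j = psi j.
Proof. by move=> Nj; rewrite /mask mem_set. Qed.

Lemma mask_out j : ~ N2 j -> mask j = 0.
Proof. by move=> Nj; rewrite /mask memNset. Qed.

Lemma frame_op_mask f : frame_op dot psi f = frameop dot mask f.
Proof.
congr summability.sum; apply/funext => j; rewrite /coef /mask.
by case: ifP => // _; rewrite scaler0.
Qed.

Variables A B : R.
Hypothesis psi_frame : is_frame dot psi A B.

Lemma frame_bessel (F : {fset nat * nat}) h : l2 F (coef dot mask h) <= Num.sqrt B * nrm h.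
Proof.
have [_ B0 /(_ h)[_ hB]] := psi_frame.
rewrite l2_le ?mulr_ge0 ?sqrtr_ge0 ?nrm_ge0 // exprMn (sqr_sqrtr (ltW B0)).
rewrite -lee_fin; apply: le_trans hB; apply: esum_ge.
pose F' := [fset j in F | j \in N2]%fset.
have finF : finite_set [set` F'] by exact: finite_fset.
exists [set` F'].
  by split => // j /=; rewrite !inE => /andP[_ /set_mem].
rewrite fsbig_finite //= set_fsetK sumEFin lee_fin.
rewrite (big_fsetID _ (fun j => j \in N2)) /= [X in _ + X]big1_seq ?addr0; last first.
  move=> j /=; rewrite !inE => /andP[_ /negP Nj].
  by rewrite /coef mask_out ?dot0r ?nrm0 ?expr0n // => /mem_set.
rewrite le_eqVlt; apply/orP; left; apply/eqP; apply: eq_big_seq => j.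
by rewrite !inE => /andP[_ /set_mem Nj]; rewrite /coef mask_in.
Qed.

Lemma frame_lower h c : (forall F : {fset nat * nat}, l2 F (coef dot mask h) <= c) ->
  Num.sqrt A * nrm h <= c.
Proof.
have [A0 _ /(_ h)[hA _]] := psi_frame; move=> hc.
have c0 : 0 <= c := le_trans (l2_ge0 _ _) (hc fset0).
rewrite -ler_sqr ?nnegrE ?mulr_ge0 ?sqrtr_ge0 ?nrm_ge0 // exprMn (sqr_sqrtr (ltW A0)).
rewrite -lee_fin; apply: le_trans hA _; apply: ge_ereal_sup => _ [X [finX XN] <-].
rewrite fsbig_finite //= sumEFin lee_fin.
have := hc (fset_set X); rewrite l2_le //; apply: le_trans.
rewrite le_eqVlt; apply/orP; left; apply/eqP; apply: eq_big_seq => j.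
by rewrite in_fset_set // => /set_mem /XN Nj; rewrite /coef mask_in.
Qed.

End frame_to_l2.

Section boxes.

Lemma mem_box n j : (j \in box n) = [&& (0 < j.1)%N, (j.1 <= n.1)%N, (0 < j.2)%N & (j.2 <= n.2)%N].
Proof.
case: n j => [n1 n2] [j1 j2] /=; apply/allpairsP/idP => [[[a b] /= [ha hb [-> ->]]]|].
  by move: ha hb; rewrite !mem_iota !add1n !ltnS => /andP[-> ->] /andP[-> ->].
by move=> /and4P[*]; exists (j1, j2); rewrite /= !mem_iota !add1n !ltnS; split=> //; apply/andP.
Qed.

Lemma box_uniq n : uniq (box n).
Proof. by apply: allpairs_uniq; rewrite ?iota_uniq // => -[a b] [c d]. Qed.

Lemma box_N2 n j : j \in box n -> N2 j.
Proof. by rewrite mem_box => /and4P[]. Qed.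

Lemma size_box n : size (box n) = (n.1 * n.2)%N.
Proof. by rewrite size_allpairs !size_iota. Qed.

Definition fbox n : {fset nat * nat} := [fset j in box n]%fset.

Lemma mem_fbox n j : (j \in fbox n) = (j \in box n).
Proof. by rewrite !inE. Qed.

Lemma big_fbox (V : nmodType) n (F : nat * nat -> V) :
  \sum_(j <- fbox n) F j = \sum_(j <- box n) F j.
Proof.
apply: perm_big; apply: uniq_perm; rewrite ?fset_uniq ?box_uniq //.
exact: mem_fbox.
Qed.

Lemma notin_box n j : N2 j -> j \notin box n -> (n.1 < j.1)%N || (n.2 < j.2)%N.
Proof. by case=> h1 h2; rewrite mem_box h1 h2 /= negb_and -!ltnNge. Qed.

Lemma maxnorm_notin_box n j : N2 j -> j \notin box n ->
  (minn n.1 n.2 <= maxnorm j)%N.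
Proof. by move=> Nj /(notin_box Nj); rewrite /maxnorm; lia. Qed.

End boxes.

(** * Projection onto H_n and invertibility of V *)

Section finite_section.
Context {R : realType} {k : scalars}.
Local Notation K := (scal_field R k).
Variables (H : completeNormedModType K) (dot : {dot H for @sconj R k}).
Hypothesis dot_norm : induces_norm dot.
Variables (psi : nat * nat -> H) (n : nat * nat).
Hypothesis gram_unit : gram dot psi n \in unitmx.

Local Notation p := (size (box n)).

Definition atom (a : 'I_p) : H := psi (nth (0, 0)%N (box n) a).

Definition synth (v : 'rV[K]_p) : H := \sum_a v 0 a *: atom a.

Lemma big_box (V : nmodType) (F : nat * nat -> V) :
  \sum_(j <- box n) F j = \sum_(a < p) F (nth (0, 0)%N (box n) a).
Proof. by rewrite (big_nth (0, 0)%N) big_mkord. Qed.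

Lemma HnP f : Hn psi n f <-> exists v, f = synth v.
Proof.
split=> [[c ->]|[v ->]].
  exists (\row_a c (nth (0, 0)%N (box n) a)); rewrite big_box.
  by apply: eq_bigr => a _; rewrite mxE.
exists (fun j => if insub (index j (box n)) is Some a then v 0 a else 0).
rewrite big_box; apply: eq_bigr => a _.
by rewrite index_uniq ?box_uniq // valK.
Qed.

Lemma synthB u v : synth (u - v) = synth u - synth v.
Proof. by rewrite -sumrB; apply: eq_bigr => a _; rewrite !mxE scalerBl. Qed.

Lemma HnB f g : Hn psi n f -> Hn psi n g -> Hn psi n (f - g).
Proof.
by move=> /HnP[u ->] /HnP[v ->]; apply/HnP; exists (u - v); rewrite synthB.
Qed.

Lemma gram_mul v b : (v *m gram dot psi n) 0 b = dot (synth v) (atom b).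
Proof.
by rewrite mxE dot_suml; apply: eq_bigr => a _; rewrite mxE dotZl.
Qed.

Lemma mxform_gram v w : mxform (gram dot psi n) v w = dot (synth v) (synth w).
Proof.
by rewrite [synth w]/synth dot_sumr; apply: eq_bigr => b _; rewrite gram_mul dotZr mulrC.
Qed.

Lemma orth_atoms f : (forall b, dot f (atom b) = 0) -> forall h, Hn psi n h -> dot f h = 0.
Proof.
by move=> f0 h /HnP[v ->]; rewrite dot_sumr big1 // => b _; rewrite dotZr f0 mulr0.
Qed.

Lemma orth_proj_ex f : exists g, is_orth_proj dot (Hn psi n) f g.
Proof.
pose y := \row_b dot f (atom b).
exists (synth (y *m invmx (gram dot psi n))); split; first by apply/HnP; eexists.
apply: orth_atoms => b; rewrite dotBl -gram_mul mulmxKV // mxE.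
exact: subrr.
Qed.

Lemma Pn_proj f : is_orth_proj dot (Hn psi n) f (Pn dot psi n f).
Proof. exact: xgetPex (orth_proj_ex f). Qed.

Lemma Pn_Hn f : Hn psi n (Pn dot psi n f).
Proof. by case: (Pn_proj f). Qed.

Lemma dot_Pn f h : Hn psi n h -> dot (Pn dot psi n f) h = dot f h.
Proof.
case: (Pn_proj f) => _ /(_ h) Pf /Pf /eqP; rewrite dotBl subr_eq0.
by move=> /eqP ->.
Qed.

Lemma Hn_inj f g : Hn psi n f -> Hn psi n g ->
  (forall h, Hn psi n h -> dot f h = dot g h) -> f = g.
Proof.
move=> Hf Hg fg; apply/eqP; rewrite -subr_eq0; apply/eqP/nrm_eq0/eqP.
rewrite -sqrf_eq0 -(@inKK R k (_ ^+ 2)) -(dotxx dot_norm) dotBl fg; last exact: HnB.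
by rewrite subrr raddf0.
Qed.

Lemma gram_herm : mxherm (gram dot psi n).
Proof. by move=> a b; rewrite !mxE dotC. Qed.

Lemma gram_coercive : N2 n -> 0 < lambda_min (gram dot psi n) /\
  forall v, lambda_min (gram dot psi n) * sqnorm v <= nrm (synth v) ^+ 2.
Proof.
case=> n1 n2; have p0 : (0 < p)%N by rewrite size_box muln_gt0 n1.
have q v : sre (mxform (gram dot psi n) v v) = nrm (synth v) ^+ 2.
  by rewrite mxform_gram (dotxx dot_norm) inKK.
have psd v : 0 <= sre (mxform (gram dot psi n) v v) by rewrite q sqr_ge0.
have [l0 lP] := lambda_min_coercive p0 gram_herm psd gram_unit.
by split=> // v; rewrite -q.
Qed.

Variable m : nat * nat.
Local Notation T := (partial_frame_op dot psi m).

Lemma partial_frame_opB f g : T (f - g) = T f - T g.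
Proof. by rewrite -sumrB; apply: eq_bigr => j _; rewrite dotBl scalerBl. Qed.

Lemma partial_frame_op_synth v : T (synth v) = \sum_a v 0 a *: T (atom a).
Proof.
rewrite /T; under [RHS]eq_bigr do rewrite scaler_sumr.
rewrite exchange_big /=; apply: eq_bigr => j _.
rewrite dot_suml scaler_suml; apply: eq_bigr => a _.
by rewrite dotZl scalerA.
Qed.

Variable A' : R.
Hypothesis A'_gt0 : 0 < A'.
Hypothesis T_coercive : forall h, Hn psi n h -> A' * nrm h ^+ 2 <= sre (dot (T h) h).

Lemma partial_frame_op_eq0 h : Hn psi n h -> dot (T h) h = 0 -> h = 0.
Proof.
move=> Hh Th; have := T_coercive Hh; rewrite Th raddf0 => le0.
apply/nrm_eq0/eqP; rewrite -sqrf_eq0 eq_le sqr_ge0 andbT.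
by rewrite -(ler_pM2l A'_gt0) mulr0.
Qed.

Lemma synth_eq0 v : synth v = 0 -> v = 0.
Proof.
move=> sv; apply/eqP; rewrite -[v](mulmxK gram_unit).
suff -> : v *m gram dot psi n = 0 by rewrite mul0mx.
by apply/rowP => b; rewrite gram_mul sv dot0l mxE.
Qed.

(** Tested against H_n the projection disappears, so coercivity gives injectivity. For surjectivity
    the equation becomes a linear system with matrix W; a null vector of W would give h in H_n with
    [T h] orthogonal to H_n, hence h = 0. *)
Lemma Vnm_bij : set_bij (Hn psi n) (Hn psi n) (Vnm dot psi n m).
Proof.
split.
- by move=> h _; exact: Pn_Hn.
- move=> f g /set_mem Hf /set_mem Hg fg; apply/eqP; rewrite -subr_eq0; apply/eqP.
  have Hfg := HnB Hf Hg; apply: partial_frame_op_eq0 => //.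
  rewrite partial_frame_opB dotBl -(dot_Pn _ Hfg) -[dot (T g) _](dot_Pn _ Hfg).
  by rewrite -/(Vnm dot psi n m f) -/(Vnm dot psi n m g) fg subrr.
- pose W : 'M[K]_p := \matrix_(a, b) dot (T (atom a)) (atom b).
  have WE v b : (v *m W) 0 b = dot (T (synth v)) (atom b).
    rewrite mxE partial_frame_op_synth dot_suml; apply: eq_bigr => a _.
    by rewrite mxE dotZl.
  have uW : W \in unitmx.
    rewrite unitmxE unitfE; apply/negP => /det0P[v v0 vW].
    move/eqP: v0; apply; apply: synth_eq0; have Hv : Hn psi n (synth v) by apply/HnP; exists v.
    apply: partial_frame_op_eq0 => //; apply: orth_atoms Hv => b.
    by rewrite -WE vW mxE.
  move=> f Hf; pose y := \row_b dot f (atom b).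
  exists (synth (y *m invmx W)); first by apply/HnP; eexists.
  apply: Hn_inj => //; first exact: Pn_Hn.
  move=> h Hh; rewrite dot_Pn //; apply/eqP; rewrite -subr_eq0 -dotBl; apply/eqP.
  apply: orth_atoms Hh => b; rewrite dotBl -WE mulmxKV // mxE.
  exact: subrr.
Qed.

Lemma Vnm_invP f : Hn psi n f ->
  Hn psi n (Vnm_inv dot psi n m f) /\ Vnm dot psi n m (Vnm_inv dot psi n m f) = f.
Proof.
move=> Hf; have [_ _ sV] := Vnm_bij; split.
  by apply: (surjpinv_image_sub sV); exists f.
by apply: pinvK; rewrite inE; have [g Hg <-] := sV f Hf; exists g.
Qed.

End finite_section.

(** * Coercivity of the partial frame operators *)

Section section_tail.
Context {R : realType} {k : scalars}.
Local Notation K := (scal_field R k).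
Variables (H : completeNormedModType K) (dot : {dot H for @sconj R k}).
Hypothesis dot_norm : induces_norm dot.
Variables (psi : nat * nat -> H) (A B : R).
Hypothesis psi_frame : is_frame dot psi A B.
Local Notation e := (mask psi).

Let A_gt0 : 0 < A. Proof. by case: psi_frame. Qed.
Let B_gt0 : 0 < B. Proof. by case: psi_frame. Qed.
Local Notation bessel := (frame_bessel psi_frame).

Lemma l2_coef_N2 (F : {fset nat * nat}) h :
  l2 F (coef dot e h) = l2 [fset j in F | j \in N2]%fset (coef dot e h).
Proof.
congr Num.sqrt; rewrite (big_fsetID _ (fun j => j \in N2)) /=.
rewrite [X in _ + X]big1_seq ?addr0 // => j /=; rewrite !inE => /andP[_ /negP Nj].
by rewrite /coef mask_out ?dot0r ?nrm0 ?expr0n // => /mem_set.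
Qed.

Lemma partial_frame_op_mask m h :
  partial_frame_op dot psi m h = \sum_(j <- fbox m) coef dot e h j *: e j.
Proof.
rewrite big_fbox; apply: eq_big_seq => j /box_N2 Nj.
by rewrite /coef mask_in.
Qed.

Lemma partial_frame_op_le m h : nrm (partial_frame_op dot psi m h) <= B * nrm h.
Proof.
rewrite partial_frame_op_mask (le_trans (synthesis_le dot_norm bessel _ _)) //.
rewrite -[in leRHS](sqr_sqrtr (ltW B_gt0)) expr2 -mulrA ler_wpM2l ?sqrtr_ge0 //.
exact: bessel.
Qed.

Lemma dot_partial_frame_op m h :
  sre (dot (partial_frame_op dot psi m h) h) = l2 (fbox m) (coef dot e h) ^+ 2.
Proof. by rewrite partial_frame_op_mask dot_suml dot_frameop_partial inKK. Qed.

Lemma partial_frame_op_error m h C :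
  (forall F : {fset nat * nat}, (forall j, j \in F -> j \notin box m) ->
     l2 F (coef dot e h) <= C) ->
  nrm (frameop dot e h - partial_frame_op dot psi m h) <= Num.sqrt B * C.
Proof.
move=> hC.
(* Written as an unconditional sum, the partial operator is subtracted termwise, and only indices
   outside the box remain. *)
pose z j := if j \in fbox m then coef dot e h j *: e j else 0.
have zE : \sum_(j <- fbox m) z j = partial_frame_op dot psi m h.
  by rewrite partial_frame_op_mask; apply: eq_big_seq => j jm; rewrite /z jm.
have z0 : forall j, j \notin fbox m -> z j = 0 by move=> j /negbTE jm; rewrite /z jm.
have zs := sums_to_finite (k := k) (V := H) z0; rewrite zE in zs.
apply: (sums_to_le (sums_toB (frameop_sums dot_norm B_gt0 bessel h) zs)) => F.
rewrite (big_fsetID _ (mem (fbox m))) /= [X in X + _]big1_seq ?add0r; last first.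
  by move=> j; rewrite !inE /= => /andP[_ jm]; rewrite /z mem_fbox jm subrr.
set F' := [fset j | j in F & _]%fset.
have F'm j : j \in F' -> j \notin box m by rewrite !inE => /andP[].
rewrite (eq_big_seq (fun j => coef dot e h j *: e j)); last first.
  by move=> j /F'm; rewrite -mem_fbox => /z0 ->; rewrite subr0.
rewrite (le_trans (synthesis_le dot_norm bessel _ _)) // ler_wpM2l ?sqrtr_ge0 //.
exact: hC.
Qed.

Variables gamma s : R.
Hypotheses (gamma_gt0 : 0 < gamma) (s_gt2 : 2 < s).
Hypothesis psi_loc : intrinsically_localized dot psi gamma s.

Let s_gt1 : 1 < s. Proof. by move: s_gt2; lra. Qed.

(** An index outside the enlarged box leaves it through the first or the second coordinate, hence
    the 2. Each part contributes (d+1)^(1-s) / (s-1) for the coordinate that leaves and (s+1) /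
    (s-1) for the other. *)
Let tau (d : nat) : R := 2 * (s + 1) / (s - 1) ^+ 2 * d.+1%:R `^ (1 - s).

Lemma pw_dist_tail n1 d l N : (l <= n1)%N ->
  \sum_(i <- iota (n1 + d).+1 N) pw s (dist i l) <= d.+1%:R `^ (1 - s) / (s - 1).
Proof.
move=> ln; rewrite -addnS iotaDl big_map.
rewrite ler_pdivlMr ?subr_gt0 // mulrC; apply: le_trans (pw_tail N s_gt1 (ltn0Sn d)).
rewrite ler_pM2l ?subr_gt0 //; apply: ler_sum => i _.
apply: powRN_le; first by move: s_gt2; lra.
rewrite ltr_pwDl //= lerD2l ler_nat /dist; lia.
Qed.

Lemma gram_row_tail n d l (F : {fset nat * nat}) : l \in box n ->
  (forall j, j \in F -> N2 j /\ j \notin box (n.1 + d, n.2 + d)%N) ->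
  \sum_(j <- F) nrm (dot (psi l) (psi j)) ^+ 2 <= gamma ^+ 2 * tau d.
Proof.
move=> ln hF; have Nl := box_N2 ln.
apply: (@le_trans _ _ (\sum_(j <- F) gamma ^+ 2 * conv_kernel s j l)).
  rewrite big_seq [leRHS]big_seq; apply: ler_sum => j /hF [Nj _].
  have h : nrm (dot (psi l) (psi j)) <= gamma * (1 + idx_dist R j l) `^ (- s).
    by rewrite nrm_dotC; exact: psi_loc.
  apply: (@le_trans _ _ ((gamma * (1 + idx_dist R j l) `^ (- s)) ^+ 2)).
    by rewrite ler_sqr ?nnegrE ?nrm_ge0 // mulr_ge0 ?powR_ge0 // ltW.
  rewrite exprMn ler_pM2l ?exprn_gt0 // expr2 -powR_add ?ltr_pwDl ?idx_dist_ge0 //.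
  (* Squaring doubles the exponent to 2s, so each coordinate receives s: this is the case eta =
     0. *)
  have := @conv_kernel_ge R s 0; rewrite subr0 => /(_ s_gt1 j l).
  by rewrite mulrDl mul1r opprD.
rewrite -mulr_sumr ler_pM2l ?exprn_gt0 //.
have hn : l.1 \in iota 1 n.1 /\ l.2 \in iota 1 n.2.
  by move: ln; rewrite mem_box !mem_iota !add1n !ltnS => /and4P[-> -> -> ->].
have [l1 l2] : (l.1 <= n.1)%N /\ (l.2 <= n.2)%N.
  by move: ln; rewrite mem_box => /and4P[].
rewrite (big_fsetID _ (fun j => (n.1 + d < j.1)%N)) /=.
have pd c N : \sum_(i <- iota 0 N) pw s (dist i c) <= (s + 1) / (s - 1).
  by under eq_bigr do rewrite distC; exact: pw_dist_sum.
have -> : tau d = d.+1%:R `^ (1 - s) / (s - 1) * ((s + 1) / (s - 1)) +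
    (s + 1) / (s - 1) * (d.+1%:R `^ (1 - s) / (s - 1)).
  by rewrite /tau; field; rewrite gt_eqF // subr_gt0.
apply: lerD.
  apply: (@sum_prod_le _ _ (fun i => pw s (dist i l.1)) (fun i => pw s (dist i l.2))
      (n.1 + d).+1 0); rewrite ?pd //; try by move=> i; rewrite pw_ge0.
    by move=> j; rewrite !inE /= => /andP[].
  by move=> N; exact: pw_dist_tail.
apply: (@sum_prod_le _ _ (fun i => pw s (dist i l.1)) (fun i => pw s (dist i l.2))
    0 (n.2 + d).+1); rewrite ?pd //; try by move=> i; rewrite pw_ge0.
  move=> j; rewrite !inE /= => /andP[/hF[Nj jm] j1]; split => //.
  by have := notin_box Nj jm; rewrite /= (negbTE j1).
by move=> N; exact: pw_dist_tail.
Qed.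

Variable n : nat * nat.
Hypotheses (Nn : N2 n) (gram_unit : gram dot psi n \in unitmx).
Local Notation lam := (lambda_min (gram dot psi n)).

Variable d : nat.
Hypothesis d_large :
  8 * s * gamma ^+ 2 * n.1%:R * n.2%:R / (A * (s - 1) ^+ 2 * lam) <= d.+1%:R `^ (s - 1).
Local Notation m := (n.1 + d, n.2 + d)%N.

Lemma coef_section_tail h (F : {fset nat * nat}) : Hn psi n h ->
  (forall j, j \in F -> N2 j /\ j \notin box m) ->
  l2 F (coef dot e h) ^+ 2 <= A / 2 * nrm h ^+ 2.
Proof.
move=> /HnP[v ->] hF.
have [lam0 lamP] := gram_coercive dot_norm gram_unit Nn.
have s1 : 0 < s - 1 by rewrite subr_gt0.
have s0 : 0 < s by move: s_gt2; lra.
rewrite sqr_l2.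
(* Cauchy-Schwarz over the coordinates v of h. The size of the box will give n_1 n_2, and [lamP]
   turns |v|^2 into |h|^2. *)
apply: (@le_trans _ _ (\sum_(j <- F) sqnorm v * \sum_a nrm (dot (atom psi a) (psi j)) ^+ 2)).
  rewrite big_seq [leRHS]big_seq; apply: ler_sum => j /hF [Nj _].
  apply: le_trans (sum_CS _ _ _); rewrite ler_sqr ?nnegrE ?nrm_ge0 //; last first.
    by apply: sumr_ge0 => a _; rewrite mulr_ge0 ?nrm_ge0.
  rewrite /coef mask_in // dot_suml (le_trans (nrm_sum _ _ _)) //.
  by apply: ler_sum => a _; rewrite dotZl nrmM.
rewrite -mulr_sumr exchange_big /=.
apply: (@le_trans _ _ (sqnorm v * (n.1%:R * n.2%:R * (gamma ^+ 2 * tau d)))).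
  rewrite ler_wpM2l ?sqnorm_ge0 //.
  apply: (@le_trans _ _ (\sum_(a < size (box n)) gamma ^+ 2 * tau d)).
    apply: ler_sum => a _; apply: gram_row_tail hF.
    by rewrite mem_nth.
  by rewrite sumr_const card_ord -natrM -size_box mulr_natl.
apply: (@le_trans _ _ (sqnorm v * (A / 2 * lam))); last first.
  rewrite mulrCA [sqnorm v * _]mulrC ler_wpM2l ?lamP //.
  by rewrite divr_ge0 // ltW.
rewrite ler_wpM2l ?sqnorm_ge0 //.
have y0 : 0 < d.+1%:R `^ (s - 1) :> R by rewrite powR_gt0 // ltr0n.
have yV : d.+1%:R `^ (1 - s) = (d.+1%:R `^ (s - 1))^-1 :> R by rewrite -powRN opprB.
rewrite /tau yV.
have := d_large; set y := d.+1%:R `^ (s - 1) in y0 *; rewrite ler_pdivrMr ?mulr_gt0 ?exprn_gt0 // => X.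
set N := n.1%:R * n.2%:R.
have {}X : 8 * s * gamma ^+ 2 * N <= y * (A * (s - 1) ^+ 2 * lam) by rewrite /N mulrA.
have -> : N * (gamma ^+ 2 * (2 * (s + 1) / (s - 1) ^+ 2 / y)) =
   (8 * s * gamma ^+ 2 * N) * ((s + 1) / (4 * s) / ((s - 1) ^+ 2 * y)).
  by field; rewrite !gt_eqF.
have -> : A / 2 * lam = y * (A * (s - 1) ^+ 2 * lam) * (2^-1 / ((s - 1) ^+ 2 * y)).
  by field; rewrite !gt_eqF.
have sy : 0 < ((s - 1) ^+ 2 * y)^-1 by rewrite invr_gt0 mulr_gt0 ?exprn_gt0.
(* The estimate itself asks for 4 (s + 1), which the 8 s in the choice of m rounds up. *)
have s4 : (s + 1) / (4 * s) <= 2^-1.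
  by rewrite ler_pdivrMr ?mulr_gt0 //; move: s_gt2; lra.
have g2 : 0 <= gamma ^+ 2 by rewrite sqr_ge0.
apply: ler_pM => //.
- by rewrite /N !mulr_ge0 ?ler0n // ltW.
- apply: mulr_ge0; last exact: ltW.
  by apply: divr_ge0; rewrite ?addr_ge0 ?mulr_ge0 // ltW.
- by rewrite ler_pM2r.
Qed.

Lemma partial_frame_op_coercive h : Hn psi n h ->
  A / 2 * nrm h ^+ 2 <= sre (dot (partial_frame_op dot psi m h) h).
Proof.
move=> Hh; rewrite dot_partial_frame_op.
(* Any finite sum of squared coefficients is at most the part in the box of m plus A/2 |h|^2, so the
   lower frame bound gives A |h|^2 <= c. *)
pose c := l2 (fbox m) (coef dot e h) ^+ 2 + A / 2 * nrm h ^+ 2.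
have c0 : 0 <= c.
  by apply: addr_ge0; rewrite ?sqr_ge0 // mulr_ge0 ?sqr_ge0 // divr_ge0 // ltW.
have : Num.sqrt A * nrm h <= Num.sqrt c.
  apply: (frame_lower psi_frame) => F.
  rewrite l2_le ?sqrtr_ge0 // (sqr_sqrtr c0) -sqr_l2.
  apply: (@le_trans _ _ (l2 (fbox m `|` F)%fset (coef dot e h) ^+ 2)).
    rewrite !sqr_l2 (big_fset_split _ (fsubsetUr _ _)) lerDl.
    by apply: sumr_ge0 => j _; exact: sqr_ge0.
  rewrite sqr_l2 (big_fset_split _ (fsubsetUl _ _)) -!sqr_l2 lerD2l.
  rewrite l2_coef_N2; apply: coef_section_tail => // j.
  by rewrite !inE -mem_fbox => /andP[/andP[jm _] /set_mem].
rewrite -ler_sqr ?nnegrE ?mulr_ge0 ?sqrtr_ge0 ?nrm_ge0 //.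
rewrite exprMn (sqr_sqrtr (ltW A_gt0)) (sqr_sqrtr c0) /c.
set y := l2 _ _ ^+ 2; set z := nrm h ^+ 2; lra.
Qed.

End section_tail.

(** * The error estimate *)

Theorem theorem3p8 (R : realType) (k : scalars)
  (H : completeNormedModType (scal_field R k)) (dot : {dot H for @sconj R k})
  (dot_norm : induces_norm dot)
  (H_separable : separable_space H)
  (psi : nat * nat -> H) (A B : R)
  (psi_frame : is_frame dot psi A B)
  (gamma s : R) (gamma_gt0 : 0 < gamma) (s_gt2 : 2 < s)
  (psi_loc : intrinsically_localized dot psi gamma s)
  (gram_unit : forall n, N2 n -> gram dot psi n \in unitmx)
  (f : H) (c0 : R) (c0_gt0 : 0 < c0)
  (f_decay : forall j, N2 j ->
     nrm (dot f (psi j)) <= c0 * (idx_norm R j) `^ (- s))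
  (m : nat * nat -> nat * nat)
  (m_def : forall n, N2 n ->
     let d := Num.ceil
       ((8 * s * gamma ^+ 2 * n.1%:R * n.2%:R
          / (A * (s - 1) ^+ 2 * lambda_min (gram dot psi n)))
         `^ (1 / (s - 1))) in
     (m n).1%:Z = n.1%:Z + d /\ (m n).2%:Z = n.2%:Z + d) :
  exists2 c : R, 0 < c &
    forall n, N2 n ->
      set_bij (Hn psi n) (Hn psi n) (Vnm dot psi n (m n)) /\
      nrm (frame_op_inv dot psi f
          - Vnm_inv dot psi n (m n) (Pn dot psi n f))
        <= c * n.1%:R `^ (- ((s - 1) / 2)) + c * n.2%:R `^ (- ((s - 1) / 2)).
Proof.
have [A0 B0 _] := psi_frame.
pose e := mask psi; pose S := frameop dot e.
have bessel := frame_bessel psi_frame; have lower := frame_lower psi_frame.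
have /choice[Sinv SK] : forall h, exists g, S g = h.
  move=> h; apply: (lax_milgram dot_norm A0 B0).
  - exact: (frameopB dot_norm B0 bessel).
  - exact: (frameopZ dot_norm B0 bessel).
  - exact: (frameop_le dot_norm B0 bessel).
  - exact: (frameop_coercive dot_norm B0 bessel A0 lower).
pose g i := iter i Sinv f.
have gS i : S (g i.+1) = g i by rewrite /g iterS SK.
(* [frame_op_inv] picks some preimage; injectivity of S identifies it. *)
have invE : frame_op_inv dot psi f = g 1%N.
  apply: (frameop_inj dot_norm B0 bessel A0 lower).
  rewrite -[frameop _ _ (g 1%N)]/(S (g 1%N)) gS -frame_op_mask.
  apply: (pinvK (fun=> 0) (A := setT) (f := frame_op dot psi)).
  by rewrite inE; exists (g 1%N) => //; rewrite frame_op_mask; exact: gS.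
have s0 : 0 < s by lra.
(* With this eta, t - eta = 1 + (s - 1)(s - 2) / (2s), which exceeds 1 because s > 2, while eta
   stays below 1. *)
pose t := s / 2; pose eta := (s - 2) / (2 * s).
have eta0 : 0 < eta by rewrite divr_gt0 ?subr_gt0 ?mulr_gt0.
have eta1 : eta <= 1 by rewrite ler_pdivrMr ?mulr_gt0 //; lra.
have t_eta : 1 < t - eta.
  have -> : t - eta = 1 + (s - 1) * (s - 2) / (2 * s).
    by rewrite /t /eta; field; rewrite gt_eqF.
  by rewrite ltrDl divr_gt0 ?mulr_gt0 ?subr_gt0 //; lra.
have st : 2 * t = s by rewrite /t mulrC divfK.
have [D D0 weight_D] := weight_commutator eta0 eta1 t_eta.
have e_loc j l : N2 j -> N2 l ->
    nrm (dot (e j) (e l)) <= gamma * (1 + idx_dist R j l) `^ (- (2 * t)).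
  by move=> Nj Nl; rewrite /e !mask_in // st; exact: psi_loc.
have x0 j : N2 j -> nrm (coef dot e (g 0%N) j) <= c0 * (maxnorm j)%:R `^ (- (2 * t)).
  move=> Nj; rewrite st /coef /e mask_in //; apply: (le_trans (f_decay _ Nj)).
  rewrite ler_pM2l //; apply: powRN_le; first exact: ltW.
  by rewrite maxnorm_le_idx_norm andbT (lt_le_trans ltr01) // maxnorm_gt0.
have [C C0 tail] := coef_tail dot_norm A0 B0 bessel lower (@mask_out _ _ _ psi)
  gamma_gt0 eta0 t_eta e_loc D0 weight_D gS c0_gt0 x0.
have tail_box i n (F : {fset nat * nat}) : (i <= 2)%N -> N2 n ->
    (forall j, j \in F -> j \notin box n) ->
    l2 F (coef dot e (g i)) <= C * (minn n.1 n.2)%:R `^ (- t).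
  move=> i2 [n1 n2] hF; rewrite l2_coef_N2; apply: tail => //.
    by rewrite leq_min n1.
  move=> j; rewrite !inE /= => /andP[/hF jn /set_mem Nj].
  exact: maxnorm_notin_box.
(* E measures the truncation errors. The factor 2 / A comes from coercivity on H_n; it multiplies a
   consistency error E and an error B E from replacing S^-1 f by h. *)
pose E := Num.sqrt B * C; pose c := E + 2 / A * (E + B * E).
have E0 : 0 < E by rewrite mulr_gt0 // sqrtr_gt0.
have c_gt0 : 0 < c by rewrite addr_gt0 // mulr_gt0 ?divr_gt0 // addr_gt0 // mulr_gt0.
exists c => // n Nn.
have [lam0 _] := gram_coercive dot_norm (gram_unit _ Nn) Nn.
pose X := 8 * s * gamma ^+ 2 * n.1%:R * n.2%:R
  / (A * (s - 1) ^+ 2 * lambda_min (gram dot psi n)).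
have s1 : 0 < s - 1 by lra.
have X0 : 0 <= X.
  apply: divr_ge0; last by rewrite !mulr_ge0 ?exprn_ge0 // ltW.
  by rewrite !mulr_ge0 ?exprn_ge0 // ltW.
(* The ceiling is nonnegative, hence a natural number d, and d >= X^(1/(s-1)) implies the condition
   stated with d + 1. *)
have [d mE dX] : exists2 d, m n = (n.1 + d, n.2 + d)%N & X <= d.+1%:R `^ (s - 1).
  have [] := m_def _ Nn; rewrite -/X.
  have := ceil_ge (X `^ (1 / (s - 1))).
  have : 0 <= Num.ceil (X `^ (1 / (s - 1))).
    by rewrite ceil_ge0 (lt_le_trans _ (powR_ge0 _ _)) // ltrN10.
  case: (Num.ceil _) => // d _ hd; rewrite -!PoszD => -[m1] [m2].
  exists d; first by case: (m n) m1 m2 => a b /= -> ->.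
  apply: (@le_trans _ _ ((X `^ (1 / (s - 1))) `^ (s - 1))).
    by rewrite -powRrM mul1r mulVf ?gt_eqF // powRr1.
  apply: powR_le; first exact: ltW.
  by rewrite powR_ge0 /= (le_trans hd) // ler_nat.
have Vcoercive h : Hn psi n h ->
    A / 2 * nrm h ^+ 2 <= sre (dot (partial_frame_op dot psi (m n) h) h).
  rewrite mE; exact: (partial_frame_op_coercive dot_norm psi_frame gamma_gt0 s_gt2
    psi_loc Nn (gram_unit _ Nn) dX).
have A20 : 0 < A / 2 by rewrite divr_gt0.
have Vbij := Vnm_bij dot_norm (gram_unit _ Nn) A20 Vcoercive.
split=> //.
pose N : R := (minn n.1 n.2)%:R `^ (- t).
have tails i : (i <= 2)%N ->
    nrm (S (g i) - partial_frame_op dot psi n (g i)) <= E * N /\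
    nrm (S (g i) - partial_frame_op dot psi (m n) (g i)) <= E * N.
  move=> i2; rewrite /E -mulrA; split; apply: (partial_frame_op_error dot_norm psi_frame) => F hF.
    exact: tail_box.
  apply: tail_box => // j /hF; apply: contra; rewrite mE !mem_box /= => /and4P[-> h1 -> h2].
  by rewrite !(leq_trans _ (leq_addr d _)).
(* Index 2 puts h = S_n g_2 near S g_2 = S^-1 f; index 1 puts S_m g_1 near S g_1 = f. *)
have [[gh _] [_ fg]] := (tails 2%N isT, tails 1%N isT).
rewrite !gS in gh fg.
set h := partial_frame_op dot psi n (g 2) in gh.
have Hh : Hn psi n h by exists (fun j => dot (g 2%N) (psi j)).
have [Hu Vu] := Vnm_invP dot_norm (gram_unit _ Nn) A20 Vcoercive (Pn_Hn (gram_unit _ Nn) f).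
set u := Vnm_inv _ _ _ _ _ in Hu Vu *.
pose T := partial_frame_op dot psi (m n).
have Hv : Hn psi n (u - h) := HnB Hu Hh.
have EN : 0 <= E * N by rewrite mulr_ge0 ?powR_ge0 // ltW.
have uh : nrm (u - h) <= 2 / A * (E * N + B * (E * N)).
  have [->|v0] := eqVneq (nrm (u - h)) 0.
    apply: mulr_ge0; first by rewrite divr_ge0 // ltW.
    by apply: addr_ge0 => //; apply: mulr_ge0 => //; exact: ltW.
  have nv : 0 < nrm (u - h) by rewrite lt_neqAle nrm_ge0 andbT eq_sym.
  have := Vcoercive _ Hv; rewrite partial_frame_opB -/T.
  (* Galerkin orthogonality: u - h lies in H_n, and V u = P_n f says that S_m u and f have the same
     inner products with H_n. *)
  have -> : dot (T u - T h) (u - h) = dot ((f - T (g 1%N)) + T (g 1%N - h)) (u - h).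
    rewrite /T partial_frame_opB -/T addrA subrK !dotBl; congr (_ - _).
    rewrite -(dot_Pn (gram_unit _ Nn) f Hv) -Vu.
    by rewrite (dot_Pn (gram_unit _ Nn) _ Hv).
  move=> /le_trans /(_ (sre_le_nrm _)) /le_trans /(_ (dot_CS dot_norm _ _)).
  rewrite expr2 mulrA ler_pM2r // => le.
  have -> : 2 / A = (A / 2)^-1 by rewrite invf_div.
  rewrite ler_pdivlMl //; apply: le_trans le _; apply: le_trans (nrmD _ _) _.
  apply: lerD => //; apply: le_trans (partial_frame_op_le dot_norm psi_frame _ _) _.
  by rewrite ler_pM2l.
have cN : nrm (g 1%N - u) <= c * N.
  have -> : g 1%N - u = (g 1%N - h) - (u - h) by rewrite opprB addrA subrK.
  apply: le_trans (nrmB _ _) _.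
  have -> : c * N = E * N + 2 / A * (E * N + B * (E * N)) by rewrite /c; ring.
  exact: lerD.
rewrite invE; apply: le_trans cN _; rewrite -mulrDr ler_pM2l //.
have [n1 n2] := Nn.
(* The error is bounded by the power -s/2 of the minimum, which is at most its power -(s-1)/2. The
   minimum is one of n_1, n_2, so one of the two terms suffices. *)
have Nmin : N <= (minn n.1 n.2)%:R `^ (- ((s - 1) / 2)).
  apply: ler_powR; first by rewrite ler1n leq_min n1.
  by rewrite lerN2 /t; lra.
apply: le_trans Nmin _; rewrite /minn; case: ifP => _.
  by rewrite lerDl powR_ge0.
by rewrite lerDr powR_ge0.
Qed.
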